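(* Let $n\ge1$ and let $c,d$ be complex parameters. The two sequences (indexed by $n$-tuples $\boldsymbol k$ of nonnegative integers) \begin{align*} \alpha_{\boldsymbol k}(a,b)&:=\frac{\theta(aq^{2|\boldsymbol k|};p)}{\theta(a;p)}\frac{(a,\,c,\,d;q,p)_{|\boldsymbol k|}}{(aq/c,\,aq/d;q,p)_{|\boldsymbol k|}\prod_{r,s=1}^n(qx_r/x_s;q,p)_{k_r}}\\ &\quad\times\prod_{r=1}^n\frac{(a^2q/(bcdx_r);q,p)_{|\boldsymbol k|}}{(a^2q/(bcdx_r);q,p)_{|\boldsymbol k|-k_r}(bcdx_r/a;q,p)_{k_r}}\cdot\left(\frac ba\right)^{|\boldsymbol k|}q^{-\sum_{r<s}k_rk_s}\prod_{r=1}^nx_r^{k_r} \end{align*} and $$\beta_{\boldsymbol k}(a,b):=\frac{(aq/(cd);q,p)_{|\boldsymbol k|}}{(aq/c,\,aq/d;q,p)_{|\boldsymbol k|}}\prod_{r,s=1}^n\frac1{(qx_r/x_s;q,p)_{k_r}}\prod_{r=1}^n\frac{(bx_r;q,p)_{|\boldsymbol k|}(bcx_r/a,\,bdx_r/a;q,p)_{k_r}}{(bcdx_r/a;q,p)_{k_r}}$$ form a WP Bailey pair with respect to the matrix $\mathbf B^{(3)}$.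
   Context: Let $q,p$ be complex numbers with $q\neq 0$ and $|p|<1$. For $a\ne 0$ put $\theta(a;p)=\prod_{j\ge 0}(1-ap^j)(1-p^{j+1}/a)$. For an integer $k$ the $q,p$-shifted factorial is $(a;q,p)_k=\prod_{j=0}^{k-1}\theta(aq^j;p)$ if $k\ge 0$ (empty product $=1$), and $(a;q,p)_{k}=\big(\prod_{j=k}^{-1}\theta(aq^{j};p)\big)^{-1}$ if $k<0$. Write $(a_1,\dots,a_m;q,p)_k=(a_1;q,p)_k\cdots(a_m;q,p)_k$. For a tuple $\boldsymbol k=(k_1,\dots,k_n)$, $|\boldsymbol k|=k_1+\cdots+k_n$; $\sum_{r<s}$ is over $1\le r<s\le n$. The $x_1,\dots,x_n$ are fixed complex parameters. All parameters are nonzero and generic in the sense that no denominators vanish. WP Bailey pair: given a matrix $\mathbf B=(B_{\boldsymbol k\boldsymbol j}(a,b))$ indexed by $n$-tuples of nonnegative integers, sequences $\alpha_{\boldsymbol N}(a,b)$ and $\beta_{\boldsymbol N}(a,b)$ form a WP Bailey pair with respect to $\mathbf B$ if for all $n$-tuples $\boldsymbol N$ of nonnegative integers $$\beta_{\boldsymbol N}(a,b)=\sum_{0\le j_r\le N_r,\ r=1,\dots,n}B_{\boldsymbol N\boldsymbol j}(a,b)\,\alpha_{\boldsymbol j}(a,b).$$ The matrix $\mathbf B^{(3)}$ has entries $$B^{(3)}_{\boldsymbol k\boldsymbol j}(a,b)=\frac{\prod_{r=1}^n(bx_r;q,p)_{j_r+|\boldsymbol k|}(bx_rq^{j_r-|\boldsymbol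 j|}/a;q,p)_{k_r-j_r}}{(aq;q,p)_{|\boldsymbol k|+|\boldsymbol j|}\prod_{r,s=1}^n(q^{1+j_r-j_s}x_r/x_s;q,p)_{k_r-j_r}}.$$ *)

(* Defs.v *)
From HB Require Import structures.
From mathcomp Require Import all_boot all_order all_algebra.
From mathcomp Require Import complex.
From mathcomp Require Import all_classical all_reals all_analysis.

Set Implicit Arguments.
Unset Strict Implicit.
Unset Printing Implicit Defensive.

Import Order.TTheory GRing.Theory Num.Theory.
Import numFieldNormedType.Exports.
Local Open Scope ring_scope.
Local Open Scope classical_set_scope.

(* The definitions are over an arbitrary numFieldType; they are meant to be
   used at the complex numbers R[i], with R : realType, where the infinite
   product converges for a != 0 and |p| < 1. *)
Definition theta (K : numFieldType) (p a : K) : K :=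
  lim ((fun M : nat =>
          \prod_(j < M) ((1 - a * p ^+ j) * (1 - p ^+ j.+1 / a))) @ \oo).

(* Negz m is the integer -(m+1); the index j = -(m+1), ..., -1 of the product
   defining the factorial of negative order is written - i.+1 with i < m.+1. *)
Definition qpfact (K : numFieldType) (q p a : K) (k : int) : K :=
  match k with
  | Posz m => \prod_(i < m) theta p (a * q ^+ i)
  | Negz m => (\prod_(i < m.+1) theta p (a * q ^- i.+1))^-1
  end.

Definition tsum (n : nat) (k : 'I_n -> nat) : nat := (\sum_r k r)%N.

Definition WP_Bailey_pair (K : numFieldType) (n : nat)
    (B : K -> K -> ('I_n -> nat) -> ('I_n -> nat) -> K)
    (alpha beta : K -> K -> ('I_n -> nat) -> K) (a b : K) : Prop :=
  forall N : 'I_n -> nat,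
    beta a b N =
    \sum_(j : {dffun forall r : 'I_n, 'I_(N r).+1})
       B a b N (fun r => j r) * alpha a b (fun r => j r).

Definition B3 (K : numFieldType) (n : nat) (q p : K) (x : 'I_n -> K)
    (a b : K) (k j : 'I_n -> nat) : K :=
  (\prod_r (qpfact q p (b * x r) (j r + tsum k)%N *
            qpfact q p (b * x r * q ^ ((j r)%:Z - (tsum j)%:Z) / a)
                       ((k r)%:Z - (j r)%:Z))) /
  (qpfact q p (a * q) (tsum k + tsum j)%N *
   \prod_r \prod_s qpfact q p (q ^ (1 + (j r)%:Z - (j s)%:Z) * x r / x s)
                              ((k r)%:Z - (j r)%:Z)).

Definition alpha3 (K : numFieldType) (n : nat) (q p : K) (x : 'I_n -> K)
    (c d a b : K) (k : 'I_n -> nat) : K :=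
  theta p (a * q ^+ (2 * tsum k)) / theta p a *
  ((qpfact q p a (tsum k) * qpfact q p c (tsum k) * qpfact q p d (tsum k)) /
   (qpfact q p (a * q / c) (tsum k) * qpfact q p (a * q / d) (tsum k) *
    \prod_r \prod_s qpfact q p (q * x r / x s) (k r))) *
  (\prod_r (qpfact q p (a ^+ 2 * q / (b * c * d * x r)) (tsum k) /
            (qpfact q p (a ^+ 2 * q / (b * c * d * x r))
                        ((tsum k)%:Z - (k r)%:Z) *
             qpfact q p (b * c * d * x r / a) (k r)))) *
  (b / a) ^+ tsum k *
  q ^- (\sum_(r < n) \sum_(s < n | (r < s)%N) k r * k s)%N *
  \prod_r x r ^+ k r.

Definition beta3 (K : numFieldType) (n : nat) (q p : K) (x : 'I_n -> K)
    (c d a b : K) (k : 'I_n -> nat) : K :=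
  qpfact q p (a * q / (c * d)) (tsum k) /
  (qpfact q p (a * q / c) (tsum k) * qpfact q p (a * q / d) (tsum k)) *
  (\prod_r \prod_s (qpfact q p (q * x r / x s) (k r))^-1) *
  \prod_r ((qpfact q p (b * x r) (tsum k) *
            (qpfact q p (b * c * x r / a) (k r) *
             qpfact q p (b * d * x r / a) (k r))) /
           qpfact q p (b * c * d * x r / a) (k r)).

(* Genericity: every parameter is nonzero and no denominator of the entries
   B3 k j with j <= k (componentwise), alpha3 k or beta3 k vanishes.  The
   denominators qpfact (q * x r / x s) (k r) of alpha3 and beta3 are the case
   j = 0 of the last condition. *)
Record generic3 (K : numFieldType) (n : nat) (q p : K) (x : 'I_n -> K)
    (c d a b : K) : Prop := Generic3 {
  generic3_a : a != 0;
  generic3_b : b != 0;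
  generic3_c : c != 0;
  generic3_d : d != 0;
  generic3_x : forall r, x r != 0;
  generic3_theta : theta p a != 0;
  generic3_aq : forall m : nat, qpfact q p (a * q) m != 0;
  generic3_aqc : forall m : nat, qpfact q p (a * q / c) m != 0;
  generic3_aqd : forall m : nat, qpfact q p (a * q / d) m != 0;
  generic3_aaq : forall (k : 'I_n -> nat) (r : 'I_n),
    qpfact q p (a ^+ 2 * q / (b * c * d * x r))
               ((tsum k)%:Z - (k r)%:Z) != 0;
  generic3_bcdx : forall (m : nat) (r : 'I_n),
    qpfact q p (b * c * d * x r / a) m != 0;
  generic3_xx : forall k j : 'I_n -> nat, (forall r, (j r <= k r)%N) ->
    forall r s, qpfact q p (q ^ (1 + (j r)%:Z - (j s)%:Z) * x r / x s)
                           ((k r)%:Z - (j r)%:Z) != 0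
}.

(* Main.v *)
Require Import Defs.
From HB Require Import structures.
From mathcomp Require Import all_boot all_order all_algebra.
From mathcomp Require Import complex.
From mathcomp Require Import all_classical all_reals all_analysis.
From mathcomp Require Import ring lra zify.

Set Implicit Arguments.
Unset Strict Implicit.
Unset Printing Implicit Defensive.

Import Order.TTheory GRing.Theory Num.Theory.
Import numFieldNormedType.Exports.
Local Open Scope ring_scope.

(** The proof uses the theta function through four properties only: it vanishes
    at 1, [theta z^-1 = - z^-1 * theta z], its zeros are closed under division,
    and it satisfies the three-term relation ([theta_like]).  The last one is the
    analytic input.  By the Jacobi triple product ([jsum_cvg]) theta is a
    bilateral series; rearranging the double series of
    [theta (x * y) * theta (x / y)] along the directions [k + l] and [k - l]
    shows that this product has the form [x * (f x * g y - g x * f y)]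
    ([theta_rank2]), and the three-term relation is the Pluecker relation for
    such an antisymmetric form of rank 2.

    Once a common factor is removed from B, alpha and beta, the claim reads
    [defect N b c = 0], where the defect is the multiple sum minus the closed
    form, [f = b * c * d / a] is regarded as a constant and [d] is eliminated.
    Fixing [f] is what makes the argument work: every term is then, as a function
    of [b], a product of [2 * |N|] theta factors [theta (y * b)] in which the
    product of the [y]'s is the same for all terms, and after multiplication by
    [c ^+ |N|] the same holds as a function of [c].  Lagrange interpolation for
    such products ([lagrange]) shows that a linear combination of them vanishes
    identically as soon as it vanishes at [2 * |N| + 1] points
    whose quotients are not zeros of theta ([theta_fun_eq0]), so it suffices to
    find enough zeros.

    One zero is explicit: if [d = a * q ^+ |N|], all terms but the one of index
    [N] vanish, and that term equals the closed form ([summand_top]).  The others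
    come from a recurrence.  A partial fraction expansion with nodes
    [x r * q ^+ N r] ([node_expansion]) expresses the value at [b] of both the
    summand and the closed form through the values at [b * q] for [N] and for the
    tuples [N] minus a unit vector, with the same coefficients ([summand_rec],
    [closed_rec]).  By induction on [|N|] the defects of the smaller tuples
    vanish, so a zero of the defect at [b * q] gives one at [b], provided that a
    certain product of thetas does not vanish; for [c = q ^+ m] with [m] large it
    does not.  This yields infinitely many zeros in [b], hence all [b] for
    infinitely many [c], hence all [b] and [c] ([defect_eq0]). *)

(** * The modulus of a complex number *)

Section Modulus.
Variable R : realType.
Local Notation C := (R[i] : numFieldType).
Implicit Types (z w : C) (u v : nat -> C).

(** The norm of R[i] takes its values in R[i]; the estimates below compare
    moduli with real series, so they need the norm as an element of R. *)
Definition modulus (z : C) : R := complex.Re `|z|.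

Lemma modulusE z : `|z| = ((modulus z)%:C)%C.
Proof. by rewrite /modulus RRe_real ?normr_real. Qed.

Lemma modulus_ge0 z : 0 <= modulus z.
Proof. by rewrite -lecR -modulusE; apply: normr_ge0. Qed.

Lemma modulusM : {morph modulus : z w / z * w}.
Proof. by move=> z w; apply: complexI; rewrite rmorphM /= -!modulusE normrM. Qed.

Lemma modulusN z : modulus (- z) = modulus z.
Proof. by apply: complexI; rewrite -!modulusE normrN. Qed.

Lemma modulus_add z w : modulus (z + w) <= modulus z + modulus w.
Proof. by rewrite -lecR rmorphD /= -!modulusE ler_normD. Qed.

Lemma modulus_sub z w : modulus (z - w) <= modulus z + modulus w.
Proof. by rewrite -(modulusN w) modulus_add. Qed.

Lemma modulusB z w : modulus z - modulus w <= modulus (z - w).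
Proof. by rewrite lerBlDr -{1}(subrK w z) modulus_add. Qed.

Lemma modulusC z w : modulus (z - w) = modulus (w - z).
Proof. by rewrite -modulusN opprB. Qed.

Lemma modulus1 : modulus 1 = 1.
Proof. by apply: complexI; rewrite -modulusE normr1. Qed.

Lemma modulus0 : modulus 0 = 0.
Proof. by apply: complexI; rewrite -modulusE normr0. Qed.

Lemma modulus_gt0 z : (0 < modulus z) = (z != 0).
Proof. by rewrite -ltcR -modulusE normr_gt0. Qed.

Lemma modulusV z : modulus z^-1 = (modulus z)^-1.
Proof. by apply: complexI; rewrite -modulusE fmorphV /= -modulusE normfV. Qed.

Lemma modulusX z n : modulus (z ^+ n) = modulus z ^+ n.
Proof. by apply: complexI; rewrite rmorphXn /= -!modulusE normrX. Qed.

Lemma modulus_prod I (r : seq I) (P : pred I) (F : I -> R[i]) :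
  modulus (\prod_(i <- r | P i) F i) = \prod_(i <- r | P i) modulus (F i).
Proof. exact: (big_morph modulus modulusM modulus1). Qed.

Lemma modulus_sum I (r : seq I) (P : pred I) (F : I -> R[i]) :
  modulus (\sum_(i <- r | P i) F i) <= \sum_(i <- r | P i) modulus (F i).
Proof.
elim/big_ind2: _ => [|x1 x2 y1 y2 h1 h2|//]; first by rewrite modulus0.
by apply: le_trans (modulus_add _ _) _; apply: lerD.
Qed.

Lemma modulus_lt1 z : (`|z| < 1) = (modulus z < 1).
Proof. by rewrite modulusE -(ltcR _ 1). Qed.

Lemma cvg0_modulus u (e : nat -> R) :
  (forall n, modulus (u n) <= e n) -> (e n @[n --> \oo] --> 0)%classic ->
  (u n @[n --> \oo] --> (0 : C))%classic.
Proof.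
move=> ue /cvgr0Pnorm_lt e0; apply/cvgr0Pnorm_lt => eps eps0.
have epsE : eps = ((complex.Re eps)%:C)%C by rewrite RRe_real // gtr0_real.
have /e0 : 0 < complex.Re eps by rewrite -ltcR -epsE.
apply: filterS => n; rewrite modulusE epsE ltcR.
by apply: le_lt_trans; apply: le_trans (ue n) (ler_norm _).
Qed.

Lemma cvg0_modulus_lt u (e : R) :
  (u n @[n --> \oo] --> (0 : C))%classic -> 0 < e -> exists n, modulus (u n) < e.
Proof.
move=> /cvgr0Pnorm_lt u0 e0.
have /u0[n _ /(_ n (leqnn n)) /=] : 0 < (e%:C)%C by rewrite (ltcR 0).
by rewrite modulusE ltcR => h; exists n.
Qed.

Lemma cvg_geometric_steps_real (v : nat -> R) (A r : R) :
  0 <= r < 1 -> (forall n, `|v n.+1 - v n| <= A * r ^+ n) ->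
  exists l : R, (v n @[n --> \oo] --> l)%classic.
Proof.
move=> /andP[r0 r1] vA.
have cs : cvgn (series (fun n => v n.+1 - v n)).
  apply: normed_cvg; apply: (@series_le_cvg _ _ (fun n => A * r ^+ n)) => //.
  - by move=> n; apply: normr_ge0.
  - by move=> n; apply: le_trans (vA n).
  - by apply: is_cvg_geometric_series; rewrite ger0_norm.
exists (limn (series (fun n => v n.+1 - v n)) + v 0%N).
have E : (fun n => series (fun n => v n.+1 - v n) n + v 0%N) = v.
  by apply: funext => n; rewrite /series /= telescope_sumr // subrK.
rewrite -{1}E.
by apply: cvgD; [exact: cs | exact: cvg_cst].
Qed.

(** Completeness of the complex numbers, in the only form used here: real and
    imaginary parts are dominated by the modulus, so both are Cauchy. *)
Lemma cvg_geometric_steps u (A r : R) :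
  0 <= r < 1 -> (forall n, modulus (u n.+1 - u n) <= A * r ^+ n) ->
  exists l : C, (u n @[n --> \oo] --> l)%classic.
Proof.
move=> r01 uA.
have [x xl] : exists l : R, ((complex.Re (u n) : R) @[n --> \oo] --> l)%classic.
  apply: (cvg_geometric_steps_real r01 (A := A)) => n; apply: le_trans (uA n).
  by rewrite -raddfB -lecR -modulusE normc_ge_Re.
have [y yl] : exists l : R, ((complex.Im (u n) : R) @[n --> \oo] --> l)%classic.
  apply: (cvg_geometric_steps_real r01 (A := A)) => n; apply: le_trans (uA n).
  rewrite -raddfB -lecR -modulusE normc_def lecR -sqrtr_sqr.
  by rewrite ler_sqrt ?lerDr ?sqr_ge0 // addr_ge0 ?sqr_ge0.
exists (x +i* y)%C.
rewrite -[X in (_ --> X)%classic]addr0.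
have -> : u = (fun n => (x +i* y)%C + (u n - (x +i* y)%C)).
  by apply: funext => n; rewrite addrC subrK.
apply: cvgD; first exact: cvg_cst.
apply: (@cvg0_modulus _ (fun n => `|complex.Re (u n) - x| + `|complex.Im (u n) - y|)).
  move=> n; case: (u n) => s t /=.
  have -> : ((s +i* t) - (x +i* y) = (s - x)%:C + 'i * (t - y)%:C)%C.
    by simpc.
  apply: le_trans (modulus_add _ _) _; rewrite modulusM.
  have nC (k : R) : modulus (k%:C)%C = `|k|.
    by rewrite /modulus normc_def /= expr0n addr0 sqrtr_sqr.
  have -> : modulus ('i)%C = 1.
    by rewrite /modulus normc_def /= expr0n add0r expr1n sqrtr1.
  by rewrite mul1r !nC.
have nz (f : nat -> R) l : (f n @[n --> \oo] --> l)%classic ->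
    (`|f n - l| @[n --> \oo] --> 0)%classic.
  move=> fl; rewrite -(normr0 R) -(subrr l); apply: cvg_norm.
  by apply: cvgB => //; apply: cvg_cst.
by rewrite -[X in (_ --> X)%classic]addr0; apply: cvgD; apply: nz.
Qed.

End Modulus.

(** * Infinite products and the zeros of theta *)

(** Since 1 + u <= exp u, the product is at most the exponential of a geometric
    series. *)
Lemma prod_bounded (R : realType) (y : nat -> R) (t r : R) (M : nat) :
  0 <= t -> 0 <= r < 1 -> (forall j, 0 <= y j <= 1 + t * r ^+ j) ->
  \prod_(j < M) y j <= expR (t / (1 - r)).
Proof.
move=> t0 /andP[r0 r1] yt.
apply: (@le_trans _ _ (expR (\sum_(j < M) t * r ^+ j))).
  rewrite expR_sum; apply: ler_prod => j _; have /andP[-> h] := yt j.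
  exact: le_trans h (expR_ge1Dx _).
rewrite ler_expR -mulr_sumr; apply: ler_wpM2l => //.
have r1' : 0 < 1 - r by rewrite subr_gt0.
rewrite -(ler_pM2r r1') mulVf ?gt_eqF // mulrC.
have -> : (1 - r) * (\sum_(i < M) r ^+ i) = 1 - r ^+ M.
  by rewrite -opprB mulNr -subrX1 opprB.
by rewrite gerBl exprn_ge0.
Qed.

Section Products.
Variable R : realType.
Local Notation C := (R[i] : numFieldType).
Implicit Types (z w a p : C).

Lemma cvgC_mul (u v : nat -> C) (l m : C) :
  (u n @[n --> \oo] --> l)%classic -> (v n @[n --> \oo] --> m)%classic ->
  (u n * v n @[n --> \oo] --> (l * m : C))%classic.
Proof. by move=> hl hm; exact: (cvgM hl hm). Qed.

Lemma cvgC_sub (u v : nat -> C) (l m : C) :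
  (u n @[n --> \oo] --> l)%classic -> (v n @[n --> \oo] --> m)%classic ->
  (u n - v n @[n --> \oo] --> (l - m : C))%classic.
Proof. by move=> hl hm; exact: (cvgB hl hm). Qed.

Lemma cvgC_cst (l : C) : (l @[n --> \oo] --> l)%classic.
Proof. exact: cvg_cst. Qed.

Lemma cvgC_unique (u : nat -> C) (l m : C) :
  (u n @[n --> \oo] --> l)%classic -> (u n @[n --> \oo] --> m)%classic -> l = m.
Proof. by move=> hl hm; rewrite -(cvg_lim _ hl) // (cvg_lim _ hm). Qed.

(** The factorial (z; p)_M of the ordinary (not elliptic) theory, a partial
    product of theta. *)
Definition poch p z (M : nat) : C := \prod_(j < M) (1 - z * p ^+ j).

Lemma pochS p z M : poch p z M.+1 = poch p z M * (1 - z * p ^+ M).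
Proof. by rewrite /poch big_ord_recr. Qed.

Lemma pochSl p z M : poch p z M.+1 = (1 - z) * poch p (z * p) M.
Proof.
rewrite /poch big_ord_recl expr0 mulr1; congr (_ * _).
by apply: eq_bigr => j _; rewrite -mulrA -exprS.
Qed.

Lemma pochD p z M N : poch p z (M + N) = poch p z M * poch p (z * p ^+ M) N.
Proof.
rewrite /poch big_split_ord /=; congr (_ * _).
by apply: eq_bigr => j _; rewrite -mulrA -exprD.
Qed.

Lemma modulus_poch p z M : modulus (poch p z M) = \prod_(j < M) modulus (1 - z * p ^+ j).
Proof. exact: modulus_prod. Qed.

Lemma poch_bounded p z : modulus p < 1 ->
  exists2 B, 0 < B & forall M, modulus (poch p z M) <= B.
Proof.
move=> p1; exists (expR (modulus z / (1 - modulus p))) => [|M]; first exact: expR_gt0.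
rewrite modulus_poch.
apply: (@prod_bounded _ (fun j => modulus (1 - z * p ^+ j))); rewrite ?modulus_ge0 // => j.
rewrite modulus_ge0 /=; apply: (le_trans (modulus_sub _ _)).
by rewrite modulus1 modulusM modulusX.
Qed.

(** The inverse of a factor 1 - z p^j is at most 1 + O(|p|^j), because the factor
    is bounded away from 0. *)
Lemma poch_inv_bounded p z (e : R) : modulus p < 1 -> 0 < e ->
  (forall j, e <= modulus (1 - z * p ^+ j)) ->
  exists2 B, 0 < B & forall M, modulus (poch p z M)^-1 <= B.
Proof.
move=> p1 e0 he; exists (expR ((modulus z / e) / (1 - modulus p))) => [|M].
  exact: expR_gt0.
rewrite modulusV modulus_poch -prodfV.
apply: (@prod_bounded _ (fun j => (modulus (1 - z * p ^+ j))^-1)).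
- by rewrite divr_ge0 ?modulus_ge0 // ltW.
- by rewrite modulus_ge0.
move=> j; have h0 : 0 < modulus (1 - z * p ^+ j) by apply: lt_le_trans (he j).
rewrite invr_ge0 (ltW h0) /= -(ler_pM2r h0) mulVf ?gt_eqF // mulrDl mul1r.
have h := modulusB 1 (z * p ^+ j).
rewrite modulus1 {1}modulusM modulusX in h.
have k : 1 <= modulus (1 - z * p ^+ j) / e by rewrite ler_pdivlMr // mul1r.
rewrite -lerBlDl.
apply: (@le_trans _ _ (modulus z * modulus p ^+ j)); first by lra.
have k2 : 0 <= modulus z * modulus p ^+ j by rewrite mulr_ge0 ?modulus_ge0 // exprn_ge0 ?modulus_ge0.
have := ler_wpM2l k2 k; rewrite mulr1 => /le_trans; apply.
by rewrite le_eqVlt; apply/orP; left; apply/eqP; ring.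
Qed.

(** Each new factor differs from 1 by O(|p|^M), so the increments are dominated
    by a geometric series. *)
Lemma modulus_pochB p z : modulus p < 1 -> exists2 B, 0 <= B &
  forall M d, modulus (poch p z (M + d) - poch p z M) <= B * modulus p ^+ M.
Proof.
move=> p1; have [B B0 hB] := poch_bounded z p1.
set r := modulus p; have r0 : 0 <= r := modulus_ge0 _.
have r1 : 0 < 1 - r by rewrite subr_gt0.
exists (B * modulus z / (1 - r)) => [|M d].
  by rewrite divr_ge0 ?mulr_ge0 ?modulus_ge0 // ltW.
suff : modulus (poch p z (M + d) - poch p z M) <=
    B * modulus z / (1 - r) * (r ^+ M - r ^+ (M + d)).
  move/le_trans; apply; apply: ler_wpM2l.
    by rewrite divr_ge0 ?mulr_ge0 ?modulus_ge0 // ltW.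
  by rewrite gerBl exprn_ge0.
elim: d => [|d IH]; first by rewrite addn0 !subrr modulus0 mulr0.
have -> : poch p z (M + d.+1) - poch p z M =
    (poch p z (M + d) - poch p z M) - poch p z (M + d) * (z * p ^+ (M + d)).
  by rewrite addnS pochS; ring.
apply: (le_trans (modulus_sub _ _)).
have -> : B * modulus z / (1 - r) * (r ^+ M - r ^+ (M + d.+1)) =
  B * modulus z / (1 - r) * (r ^+ M - r ^+ (M + d)) + B * (modulus z * r ^+ (M + d)).
  by rewrite addnS exprS; field; rewrite gt_eqF.
apply: lerD => //; rewrite !modulusM modulusX; apply: ler_wpM2r => //.
by rewrite mulr_ge0 ?modulus_ge0 ?exprn_ge0.
Qed.

Lemma poch_cvg p z : modulus p < 1 ->
  exists l : C, (poch p z M @[M --> \oo] --> l)%classic.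
Proof.
move=> p1; have [B B0 hB] := modulus_pochB z p1.
apply: (@cvg_geometric_steps _ _ B (modulus p)).
  by rewrite modulus_ge0.
by move=> n; have := hB n 1%N; rewrite addn1.
Qed.

Lemma theta_cvg p a : modulus p < 1 ->
  (poch p a M * poch p (p / a) M @[M --> \oo] --> (theta p a : C))%classic.
Proof.
move=> p1; have [l hl] := poch_cvg a p1; have [m hm] := poch_cvg (p / a) p1.
have E : (fun M : nat => \prod_(j < M) ((1 - a * p ^+ j) * (1 - p ^+ j.+1 / a)) : C) =
   (fun M => poch p a M * poch p (p / a) M).
  apply: funext => M; rewrite big_split /=; congr (_ * _).
  by apply: eq_bigr => j _; rewrite exprS mulrAC.
have h : (poch p a M * poch p (p / a) M @[M --> \oo] --> (l * m : C))%classic.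
  exact: (cvgC_mul hl hm).
by rewrite /theta E (cvg_lim _ h).
Qed.

End Products.

Section ThetaZeros.
Variables (R : realType).
Local Notation C := (R[i] : numFieldType).
Variable p : C.
Hypothesis p1 : modulus p < 1.
Implicit Types (z w a : C).

Lemma cvg_expr0 z : (z * p ^+ M @[M --> \oo] --> (0 : C))%classic.
Proof.
apply: (@cvg0_modulus _ _ (fun M => modulus z * modulus p ^+ M)) => [n|].
  by rewrite modulusM modulusX.
by apply: cvg_geometric; rewrite ger0_norm ?modulus_ge0.
Qed.

(** An infinite product without vanishing factor does not vanish, since the
    inverses of its partial products stay bounded. *)
Lemma poch_cvg_neq0 z (l : C) : (forall j, z * p ^+ j != 1) ->
  (poch p z M @[M --> \oo] --> l)%classic -> l != 0.
Proof.
move=> nz pl.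
pose y j := modulus (1 - z * p ^+ j).
have y0 j : 0 < y j by rewrite modulus_gt0 subr_eq0 eq_sym.
have y1 : (y j @[j --> \oo] --> (1 : R))%classic.
  apply/cvgrPdist_lt => e e0.
  have /cvgr0Pnorm_lt/(_ _ e0) :
      (modulus z * modulus p ^+ M @[M --> \oo] --> 0)%classic.
    by apply: cvg_geometric; rewrite ger0_norm ?modulus_ge0.
  apply: filterS => n; rewrite ger0_norm ?mulr_ge0 ?exprn_ge0 ?modulus_ge0 //.
  apply: le_lt_trans.
  rewrite -modulusX -modulusM /y.
  have h1 := modulusB 1 (z * p ^+ n); have h2 := modulus_sub 1 (z * p ^+ n).
  rewrite modulus1 in h1 h2.
  by rewrite ler_norml; apply/andP; split; lra.
have /cvg_seq_bounded[B [_ hB]] : cvgn (fun j => (y j)^-1).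
  apply/cvg_ex; exists (1^-1 : R); apply: cvgV => //; exact: oner_neq0.
have B0 : 0 < `|B| + 1 by rewrite ltr_wpDl.
have [||D D0 hD] := @poch_inv_bounded _ p z (`|B| + 1)^-1 p1.
- by rewrite invr_gt0.
- move=> j; rewrite -[leRHS]invrK lef_pV2 ?posrE ?invr_gt0 //; last exact: y0.
  have := hB (`|B| + 1); rewrite (le_lt_trans (ler_norm _)) ?ltrDl // => /(_ isT j I) /=.
  by apply: le_trans; apply: ler_norm.
apply/eqP => l0; rewrite l0 in pl.
have [|n h] := cvg0_modulus_lt pl (e := D^-1); first by rewrite invr_gt0.
have := hD n; rewrite modulusV => h2.
have nz0 : 0 < modulus (poch p z n).
  by rewrite modulus_poch; apply: prodr_gt0 => j _; apply: y0.
move: h; rewrite -ltf_pV2 ?posrE ?invr_gt0 // invrK => h.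
by have := lt_le_trans h h2; rewrite ltxx.
Qed.

Lemma poch_eq0 z j M : z * p ^+ j = 1 -> (j < M)%N -> poch p z M = 0.
Proof.
by move=> zj jM; rewrite /poch (bigD1 (Ordinal jM)) //= zj subrr mul0r.
Qed.

(** Zeros are described by two natural exponents, and not by one integral
    exponent, so that the case p = 0, where 1 is the only zero, is covered. *)
Lemma theta_eq0 z i j : z != 0 -> p ^+ i != 0 -> z * p ^+ i = p ^+ j ->
  theta p z = 0.
Proof.
move=> z0 pi0 zij.
suff : (exists k, z * p ^+ k = 1) \/ (exists k, p / z * p ^+ k = 1).
  move=> h; apply: (cvgC_unique (theta_cvg p1)).
  have [k hk] : exists k, forall M, (k < M)%N -> poch p z M * poch p (p / z) M = 0.
    case: h => -[k hk]; exists k => M kM.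
      by rewrite (poch_eq0 hk) // mul0r.
    by rewrite mulrC (poch_eq0 hk) // mul0r.
  apply: cvg_near_cst; exists k.+1 => // M /= kM; exact: hk.
have [p0|p0] := eqVneq p 0.
  have i0 : i = 0%N.
    by case: i pi0 {zij} => // i; rewrite p0 expr0n eqxx.
  left; exists 0%N; rewrite i0 in zij; rewrite zij.
  case: j zij => // j; rewrite expr0 mulr1 p0 expr0n /= => z1.
  by rewrite z1 eqxx in z0.
case: (leqP j i) => ji.
  left; exists (i - j)%N.
  have pj0 : p ^+ j != 0 by rewrite expf_neq0.
  by apply: (mulIf pj0); rewrite mul1r -mulrA -exprD subnK.
right; exists (j - i).-1.
have -> : z = p ^+ (j - i).
  by apply: (mulIf pi0); rewrite -exprD subnK // ltnW.
rewrite mulrAC -exprS prednK ?subn_gt0 // divff //.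
by rewrite expf_neq0.
Qed.

Lemma theta_eq0P z : z != 0 -> theta p z = 0 ->
  exists i j, p ^+ i != 0 /\ z * p ^+ i = p ^+ j.
Proof.
move=> z0 tz; apply: contrapT => no.
have n1 j : z * p ^+ j != 1.
  apply/eqP => h; apply: no; exists j, 0%N; split; last by [].
  by apply/eqP => h'; move/eqP: h; rewrite h' mulr0 eq_sym oner_eq0.
have n2 j : p / z * p ^+ j != 1.
  apply/eqP => h; apply: no; exists 0%N, j.+1; rewrite oner_eq0; split=> //.
  by rewrite mulr1 exprS -[z in LHS]mul1r -h; field.
have [l hl] := poch_cvg z p1; have [m hm] := poch_cvg (p / z) p1.
have := poch_cvg_neq0 n1 hl; have := poch_cvg_neq0 n2 hm.
move=> /negP m0 /negP l0.
have := cvgC_unique (theta_cvg p1) (cvgC_mul hl hm).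
rewrite tz => /esym/eqP; rewrite mulf_eq0 => /orP[|] //.
Qed.

(** The zeros are the integral powers of p (only 1 when p = 0), a group. *)
Lemma theta_zero_div s t : s != 0 -> t != 0 ->
  theta p s = 0 -> theta p t = 0 -> theta p (s / t) = 0.
Proof.
move=> s0 t0 /(theta_eq0P s0)[i [j [pi0 hs]]] /(theta_eq0P t0)[k [l [pk0 ht]]].
have pl0 : p ^+ l != 0 by rewrite -ht mulf_neq0.
apply: (@theta_eq0 _ (i + l) (j + k)).
- by rewrite mulf_neq0 ?invr_neq0.
- by rewrite exprD mulf_neq0.
by rewrite !exprD -hs -ht; field.
Qed.

Lemma theta1 : theta p 1 = 0.
Proof. by apply: (@theta_eq0 1 0%N 0%N); rewrite ?mulr1 ?expr0 ?oner_eq0. Qed.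

(** The partial products satisfy the relation up to the factors 1 - a p^M and
    1 - p^M / a, which tend to 1.  The factor 1 - a, which cancels only for a <> 1,
    forces the case distinction. *)
Lemma theta_inv a : a != 0 -> theta p a^-1 = - (a^-1 * theta p a).
Proof.
move=> a0.
have swap M : poch p a M * poch p (p / a) M * ((1 - a^-1) * (1 - a * p ^+ M)) =
  poch p a^-1 M * poch p (p / a^-1) M * ((1 - a) * (1 - a^-1 * p ^+ M)).
  have h b : (1 - b) * poch p (p * b) M = poch p b M * (1 - b * p ^+ M).
    by rewrite -pochS pochSl [b * p]mulrC.
  rewrite invrK.
  transitivity ((poch p a M * (1 - a * p ^+ M)) * ((1 - a^-1) * poch p (p / a) M)).
    by ring.
  by rewrite (h a^-1) -(h a); ring.
have lim1 b : (1 - b * p ^+ M @[M --> \oo] --> (1 : C))%classic.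
  rewrite -[X in (_ --> X)%classic](subr0 (1 : C)); apply: cvgC_sub; first exact: cvgC_cst.
  exact: cvg_expr0.
have limt b : (poch p b M * poch p (p / b) M * ((1 - b^-1) * (1 - b * p ^+ M))
    @[M --> \oo] --> (theta p b * ((1 - b^-1) * 1) : C))%classic.
  apply: cvgC_mul; first exact: theta_cvg.
  by apply: cvgC_mul; [exact: cvgC_cst | exact: lim1].
have := limt a; under eq_fun do rewrite swap.
have := limt a^-1; rewrite invrK => h1 h2.
have := cvgC_unique h1 h2; rewrite !mulr1 => E.
have [a1|na1] := eqVneq a 1.
  by rewrite a1 invr1 theta1 mulr0 oppr0.
apply: (mulIf (_ : 1 - a != 0)); first by rewrite subr_eq0 eq_sym.
by rewrite E; field.
Qed.

End ThetaZeros.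

(** * The Jacobi triple product *)

(** The ratio test. *)
Lemma half_ratio_bounded (R : realType) (t : nat -> R) (J : nat) :
  (forall m, 0 <= t m) -> (forall m, (J <= m)%N -> t m.+1 <= t m / 2) ->
  exists B, forall M, \sum_(m < M) t m <= B.
Proof.
move=> t0 ht; exists (\sum_(m < J) t m + 2 * t J) => M.
have tail m : \sum_(i < J + m) t i + 2 * t (J + m)%N <= \sum_(i < J) t i + 2 * t J.
  elim: m => [|m IH]; first by rewrite addn0.
  apply: le_trans IH; rewrite addnS big_ord_recr /= -addrA lerD2l.
  have := ht (J + m)%N (leq_addr _ _); lra.
have mono : \sum_(i < M) t i <= \sum_(i < J + M) t i.
  by rewrite addnC big_split_ord /= lerDl sumr_ge0.
by have := tail M; have := t0 (J + M)%N; lra.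
Qed.

Section Bilateral.

(** The index sets |k| <= L of the symmetric partial sums of a bilateral series. *)
Definition window (L : nat) : seq int := [seq i%:Z - L%:Z | i <- iota 0 L.*2.+1].

Lemma mem_window L (k : int) : (k \in window L) = (- L%:Z <= k <= L%:Z).
Proof.
apply/mapP/idP => [[m]|h].
  by rewrite mem_iota add0n => /andP[_ hm] ->; lia.
by exists (absz (k + L%:Z)); [rewrite mem_iota; lia | lia].
Qed.

Lemma window_uniq L : uniq (window L).
Proof. by rewrite map_inj_uniq ?iota_uniq // => i j; lia. Qed.

Lemma big_window (V : nmodType) L (F : int -> V) :
  \sum_(k <- window L) F k = \sum_(i < L.*2.+1) F (i%:Z - L%:Z).
Proof. by rewrite big_map -(big_mkord xpredT (fun i => F (i%:Z - L%:Z))) /index_iota subn0. Qed.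

Lemma big_windowS (V : zmodType) L (F : int -> V) :
  \sum_(k <- window L.+1) F k =
  \sum_(k <- window L) F k + (F L.+1%:Z + F (- L.+1%:Z)).
Proof.
rewrite !big_window doubleS big_ord_recl big_ord_recr /=.
rewrite addrC -addrA; congr (_ + _).
  by apply: eq_bigr => i _; congr F; rewrite /bump /=; lia.
by congr (F _ + F _); rewrite ?/bump /=; lia.
Qed.

Lemma big_window_half (V : zmodType) L (F : int -> V) :
  \sum_(k <- window L) F k = F 0 + \sum_(m < L) (F m.+1%:Z + F (- m.+1%:Z)).
Proof.
elim: L => [|L IH]; last by rewrite big_windowS IH big_ord_recr /= -!addrA.
by rewrite big_ord0 addr0 big_window big_ord1.
Qed.

(** The two sums differ by the terms of s2 outside s1, which are also in s3. *)
Lemma modulus_sum_diff (R : realType) (I : eqType) (s1 s2 s3 : seq I)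
    (F : I -> (R[i] : numFieldType)) :
  uniq s1 -> uniq s2 -> uniq s3 -> {subset s1 <= s2} -> {subset s2 <= s3} ->
  modulus (\sum_(i <- s2) F i - \sum_(i <- s1) F i) <=
  \sum_(i <- s3) modulus (F i) - \sum_(i <- s1) modulus (F i).
Proof.
move=> u1 u2 u3 s12 s23.
have split_sum (V : nmodType) (G : I -> V) (s t : seq I) : uniq s -> uniq t ->
    {subset s <= t} ->
    \sum_(i <- t) G i = \sum_(i <- s) G i + \sum_(i <- t | i \notin s) G i.
  move=> us ut st; rewrite (bigID (mem s)) /=; congr (_ + _).
  rewrite -big_filter; apply: perm_big; apply: uniq_perm; rewrite ?filter_uniq //.
  by move=> i; rewrite mem_filter; case: (boolP (i \in s)) => //= /st ->.
rewrite (split_sum _ _ _ _ u1 u2 s12) addrC addKr.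
rewrite (split_sum _ _ s1 s3) // => [|i /s12/s23 //].
rewrite [leRHS]addrC addKr; apply: le_trans (modulus_sum _ _ _) _.
rewrite -big_filter -[leRHS]big_filter.
rewrite [leRHS](split_sum _ _ [seq i <- s2 | i \notin s1]) ?filter_uniq //.
  by rewrite lerDl sumr_ge0 // => i _; apply: modulus_ge0.
by move=> i; rewrite !mem_filter => /andP[-> /s23].
Qed.

End Bilateral.

Section GaussianBinomial.
Variables (R : realType).
Local Notation C := (R[i] : numFieldType).
Variable p : C.

(** Gaussian binomial coefficients, through a Pascal rule: no division is needed,
    so the definition makes sense for every p. *)
Fixpoint qbinom (n i : nat) : C :=
  match n, i with
  | _, 0 => 1
  | 0, _.+1 => 0
  | n.+1, i.+1 => qbinom n i.+1 + p ^+ (n - i) * qbinom n i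
  end.

Lemma qbinomn0 n : qbinom n 0 = 1. Proof. by case: n. Qed.

Lemma qbinom_small n i : (n < i)%N -> qbinom n i = 0.
Proof.
elim: n i => [|n IH] [|i] //= h; rewrite !IH ?mulr0 ?addr0 //.
exact: ltnW.
Qed.

Lemma qbinom_poch n i : (i <= n)%N ->
  qbinom n i * poch p p i * poch p p (n - i) = poch p p n.
Proof.
elim: n i => [|n IH] [|i] // hi; rewrite ?subn0.
- by rewrite /poch !big_ord0 !mulr1.
- by rewrite qbinomn0 {1}/poch big_ord0 !mul1r.
rewrite subSS /= mulrDl mulrDl.
have E2 : p ^+ (n - i) * qbinom n i * poch p p i.+1 * poch p p (n - i) =
    p ^+ (n - i) * (1 - p ^+ i.+1) * poch p p n.
  by rewrite -(IH i) // pochS exprS; ring.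
have E1 : qbinom n i.+1 * poch p p i.+1 * poch p p (n - i) = (1 - p ^+ (n - i)) * poch p p n.
  move: hi; rewrite ltnS leq_eqVlt => /orP[/eqP ->|hi].
    by rewrite subnn expr0 subrr mul0r qbinom_small // !mul0r.
  rewrite -(IH i.+1) // (_ : (n - i = (n - i.+1).+1)%N); last by rewrite subnSK.
  by rewrite !pochS exprS; ring.
rewrite E1 E2 pochS.
have -> : p ^+ (n - i) * (1 - p ^+ i.+1) = p ^+ (n - i) - p * p ^+ n.
  by rewrite mulrBr mulr1 -exprD -exprS addnS subnK.
by ring.
Qed.

(** The finite binomial theorem of Cauchy and Rothe. *)
Lemma poch_qbinom z n :
  poch p z n = \sum_(i < n.+1) p ^+ 'C(i, 2) * (- z) ^+ i * qbinom n i.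
Proof.
elim: n => [|n IH].
  by rewrite /poch big_ord0 big_ord1 /= bin_small // !expr0 !mulr1.
rewrite pochS IH mulrBr mulr1 mulr_suml.
rewrite [RHS]big_ord_recl.
under [X in _ = _ + X]eq_bigr => i _.
  rewrite !lift0 /= mulrDr.
  over.
rewrite big_split /= addrA; congr (_ + _).
  rewrite [in LHS]big_ord_recl [in RHS]big_ord_recr /= (qbinom_small (ltnSn n)) mulr0 addr0.
  by congr (_ + _); rewrite qbinomn0.
rewrite -sumrN; apply: eq_bigr => i _.
have hi : (i <= n)%N by rewrite -ltnS.
have pn : p ^+ n = p ^+ (n - i) * p ^+ i by rewrite -exprD subnK.
by rewrite binS bin1 !exprD !exprS pn; ring.
Qed.

End GaussianBinomial.

Section TripleProduct.
Variables (R : realType).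
Local Notation C := (R[i] : numFieldType).
(** s is a square root of the nome, which keeps the exponents integral. *)
Variable s : C.
Hypothesis s0 : s != 0.
Local Notation p := (s ^+ 2).

(** The term p^(k(k-1)/2) (-a)^k of the Jacobi series, for p = s^2. *)
Definition jterm (a : C) (k : int) : C := s ^ (k * k - k) * (- a) ^ k.

(** Finite form of the triple product: the Cauchy-Rothe formula of length 2M for
    the argument a p^(-M), whose first M factors turn into those of (p/a; p)_M. *)
Lemma triple_product_poch a M : a != 0 ->
  poch p a M * poch p (p / a) M =
  \sum_(i < M.*2.+1) jterm a (i%:Z - M%:Z) * qbinom p M.*2 i.
Proof.
move=> a0; have na0 : - a != 0 by rewrite oppr_eq0.
have pn0 n : p ^+ n != 0 by do 2!apply: expf_neq0.
have flip : poch p (p / a) M =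
    s ^ (M%:Z * M%:Z + M%:Z) * (- a) ^ (- M%:Z) * poch p (a * p ^- M) M.
  elim: M => [|M IH]; first by rewrite /poch !big_ord0 !mulr0 addr0 oppr0 !expr0z !mulr1.
  rewrite pochS IH pochSl.
  have -> : a * p ^- M.+1 * p = a * p ^- M.
    by rewrite exprS; field; rewrite s0 pn0.
  have -> : s ^ (M.+1%:Z * M.+1%:Z + M.+1%:Z) = s ^ (M%:Z * M%:Z + M%:Z) * p ^+ M.+1.
    by rewrite -exprM exprnP -expfzDr //; congr (_ ^ _); lia.
  have -> : (- a) ^ (- M.+1%:Z) = (- a) ^ (- M%:Z) * (- a)^-1.
    by rewrite -exprN1 -expfzDr //; congr (_ ^ _); lia.
  set P := poch _ _ _.
  have -> : 1 - p / a * p ^+ M = - p ^+ M.+1 * a^-1 * (1 - a * p ^- M.+1).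
    by rewrite !(exprS p); field; rewrite s0 a0 pn0.
  rewrite invrN; ring.
have E : poch p (a * p ^- M) M.*2 = poch p (a * p ^- M) M * poch p a M.
  by rewrite -addnn pochD divfK.
transitivity (s ^ (M%:Z * M%:Z + M%:Z) * (- a) ^ (- M%:Z) * poch p (a * p ^- M) M.*2).
  by rewrite flip E; ring.
rewrite poch_qbinom mulr_sumr; apply: eq_bigr => i _; rewrite mulrA; congr (_ * _).
have -> : p ^+ 'C(i, 2) = s ^ (i%:Z * i%:Z - i%:Z).
  rewrite -exprM exprnP; congr (_ ^ _).
  by elim: (nat_of_ord i) => [|m IHm] //; rewrite binS bin1; lia.
have -> : (- (a * p ^- M)) ^+ i = (- a) ^ i * s ^ (- (2 * M%:Z * i%:Z)).
  rewrite -mulNr exprMn; congr (_ * _).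
  by rewrite exprVn -!exprM exprnN; congr (_ ^ _); lia.
have Es : s ^ ((i%:Z - M%:Z) * (i%:Z - M%:Z) - (i%:Z - M%:Z)) =
    s ^ (M%:Z * M%:Z + M%:Z) * s ^ (i%:Z * i%:Z - i%:Z) * s ^ (- (2 * M%:Z * i%:Z)).
  by rewrite -!expfzDr //; congr (_ ^ _); ring.
have Ea : (- a) ^ (i%:Z - M%:Z) = (- a) ^ (- M%:Z) * (- a) ^ i.
  by rewrite -expfzDr // addrC.
by rewrite /jterm Es Ea; ring.
Qed.

End TripleProduct.

Section JacobiSeries.
Variables (R : realType).
Local Notation C := (R[i] : numFieldType).
Variable s : C.
Hypothesis s0 : s != 0.
Local Notation p := (s ^+ 2).
Hypothesis p1 : modulus p < 1.
Local Notation r := (modulus p).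

Lemma jterm_succ a k : a != 0 -> jterm s a (k + 1) = jterm s a k * (- a) * s ^ (2 * k).
Proof.
move=> a0; have na0 : - a != 0 by rewrite oppr_eq0.
have Es : s ^ ((k + 1) * (k + 1) - (k + 1)) = s ^ (k * k - k) * s ^ (2 * k).
  by rewrite -expfzDr //; congr (_ ^ _); ring.
have Ea : (- a) ^ (k + 1) = (- a) ^ k * (- a) by rewrite expfzDr // expr1z.
by rewrite /jterm Es Ea; ring.
Qed.

Lemma jterm_pred a k : a != 0 ->
  jterm s a (k - 1) = jterm s a k * (- a)^-1 * s ^ (2 * (1 - k)).
Proof.
move=> a0; have na0 : - a != 0 by rewrite oppr_eq0.
have Es : s ^ ((k - 1) * (k - 1) - (k - 1)) = s ^ (k * k - k) * s ^ (2 * (1 - k)).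
  by rewrite -expfzDr //; congr (_ ^ _); ring.
have Ea : (- a) ^ (k - 1) = (- a) ^ k * (- a)^-1 by rewrite expfzDr // exprN1.
by rewrite /jterm Es Ea; ring.
Qed.

Lemma r_gt0 : 0 < r. Proof. by rewrite modulus_gt0 expf_neq0. Qed.

(** Partial sums of the series of absolute values. *)
Definition jmass (a : C) (L : nat) : R := \sum_(k <- window L) modulus (jterm s a k).

Lemma r_pow_small (x : R) : 0 <= x ->
  exists J, forall m, (J <= m)%N -> x * r ^+ m <= 1 / 2.
Proof.
move=> x0.
have /cvgr0Pnorm_lt/(_ (1 / 2)) : (x * r ^+ M @[M --> \oo] --> 0)%classic.
  by apply: cvg_geometric; rewrite ger0_norm ?modulus_ge0.
move=> /(_ _)[|J _ hJ]; first by lra.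
exists J => m Jm; apply: ltW; have := hJ m Jm => /=.
by rewrite ger0_norm // mulr_ge0 ?exprn_ge0 ?modulus_ge0.
Qed.

(** Consecutive terms have ratio O(|p|^m) on both sides of the series, so the
    ratio test applies. *)
Lemma jmass_bounded a : a != 0 -> exists B, forall L, jmass a L <= B.
Proof.
move=> a0.
have [J1 h1] := r_pow_small (modulus_ge0 a).
have [J2 h2] := r_pow_small (modulus_ge0 (a^-1)).
pose t m := modulus (jterm s a m.+1%:Z) + modulus (jterm s a (- m.+1%:Z)).
have [||B hB] := @half_ratio_bounded _ t (maxn J1 J2).
- by move=> m; rewrite addr_ge0 ?modulus_ge0.
- move=> m; rewrite geq_max => /andP[m1 m2]; rewrite /t.
  have E1 : modulus (jterm s a m.+2%:Z) = modulus (jterm s a m.+1%:Z) * (modulus a * r ^+ m.+1).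
    rewrite (_ : m.+2%:Z = m.+1%:Z + 1) ?jterm_succ //; last by lia.
    rewrite (_ : 2 * m.+1%:Z = (2 * m.+1)%N%:Z) // -exprnP exprM.
    by rewrite modulusM (modulusM (jterm _ _ _)) modulusN (modulusX p) mulrA.
  have E2 : modulus (jterm s a (- m.+2%:Z)) =
      modulus (jterm s a (- m.+1%:Z)) * (modulus a^-1 * r ^+ m.+2).
    rewrite (_ : - m.+2%:Z = - m.+1%:Z - 1); last by lia.
    rewrite jterm_pred // (_ : 2 * (1 - - m.+1%:Z) = (2 * m.+2)%N%:Z); last by lia.
    rewrite -exprnP exprM.
    by rewrite modulusM (modulusM (jterm _ _ _)) invrN modulusN (modulusX p) mulrA.
  rewrite E1 E2 mulrDl.
  have k1 := h1 m.+1 (leqW m1); have k2 := h2 m.+2 (leqW (leqW m2)).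
  apply: lerD; apply: ler_wpM2l; rewrite ?modulus_ge0 //; lra.
exists (modulus (jterm s a 0) + B) => L.
by rewrite /jmass big_window_half lerD2l.
Qed.

Lemma jmass_cvg a : a != 0 -> exists l : R, (jmass a L @[L --> \oo] --> l)%classic.
Proof.
move=> a0; have [B hB] := jmass_bounded a0.
exists (limn (jmass a)).
have h : cvgn (jmass a); last exact: h.
apply: nondecreasing_is_cvgn.
  apply/nondecreasing_seqP => n; rewrite /jmass big_windowS lerDl.
  by rewrite addr_ge0 ?modulus_ge0.
by exists B => _ [n _ <-].
Qed.

Lemma jterm_scale a z k : jterm s (a * z) k = jterm s a k * z ^ k.
Proof. by rewrite /jterm -mulNr expfzMl mulrA. Qed.

Lemma pp_neq1 j : p * p ^+ j != 1.
Proof.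
apply/eqP => /(congr1 (@modulus R)); rewrite -exprS modulusX modulus1 => h.
by have := exprn_ilt1 j.+1 (ltW r_gt0) p1; rewrite h ltxx.
Qed.

Lemma poch_pp_neq0 n : poch p p n != 0.
Proof. by apply/prodf_neq0 => j _; rewrite subr_eq0 eq_sym pp_neq1. Qed.

Lemma poch_pp_inv_bounded : exists2 B, 0 < B & forall M, modulus (poch p p M)^-1 <= B.
Proof.
apply: (@poch_inv_bounded _ _ _ (1 - r)) => //; first by rewrite subr_gt0.
move=> j; have := modulusB 1 (p * p ^+ j).
rewrite modulus1 (_ : modulus (p * p ^+ j) = r ^+ j.+1); last by rewrite -exprS (modulusX p).
have : r ^+ j.+1 <= r by rewrite exprS ger_pMr ?r_gt0 // exprn_ile1 // ltW // r_gt0.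
by lra.
Qed.

(** Jacobi triple product.  In the finite identity, multiplied by (p)_L^2 / (p)_2L,
    the k-th term of the series is multiplied by a factor that differs from 1 by
    O(|p|^(L+k) + |p|^(L-k)).  The weights |p|^k and |p|^(-k) only replace a by
    a p and a / p in the series, which converges absolutely at these points too, so
    the total error is O(|p|^L). *)
Lemma jsum_cvg a l : a != 0 -> (poch p p M @[M --> \oo] --> (l : C))%classic ->
  (\sum_(k <- window L) jterm s a k @[L --> \oo] --> (l * theta p a : C))%classic.
Proof.
move=> a0 hl.
have l0 : l != 0 := poch_cvg_neq0 p1 pp_neq1 hl.
(* c M tends to the same limit as (p; p)_M and makes the coefficients of the
   finite identity tend to 1. *)
pose c M := poch p p M * poch p p M * (poch p p M.*2)^-1.
have hc : (c M @[M --> \oo] --> (l : C))%classic.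
  have -> : l = l * l * l^-1 by rewrite mulfK.
  apply: cvgC_mul; first exact: (cvgC_mul hl hl).
  apply: cvgV => //; apply: (cvg_comp _ _ _ hl).
  by move=> A [n _ hA]; exists n => // m /= nm; apply: hA => /=; lia.
have [B hB] : exists B, forall L, modulus (c L * (poch p a L * poch p (p / a) L) -
    \sum_(k <- window L) jterm s a k) <= B * r ^+ L.
  have [B1 B10 hB1] := poch_bounded p p1.
  have [B2 B20 hB2] := poch_pp_inv_bounded.
  have [B3 B30 hB3] := modulus_pochB p p1.
  have [B4 hB4] := jmass_bounded (mulf_neq0 a0 (expf_neq0 2 s0)).
  have [B5 hB5] := jmass_bounded (mulf_neq0 a0 (invr_neq0 (expf_neq0 2 s0))).
  have [ip hip] : exists ip, p^-1 = ip by exists p^-1.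
  rewrite hip in hB5.
  pose A := B2 * B2 * (B1 * B3 *+ 2).
  have A0 : 0 <= A by rewrite /A !mulr_ge0 ?mulrn_wge0 ?mulr_ge0 // ltW.
  exists (A * (B4 + B5)) => L.
  have [j1 hj1] : exists f, forall k, modulus (jterm s (a * p) k) = f k by exists (fun k => modulus (jterm s (a * p) k)).
  have [j2 hj2] : exists f, forall k, modulus (jterm s (a * ip) k) = f k by exists (fun k => modulus (jterm s (a * ip) k)).
  rewrite triple_product_poch // mulr_sumr big_window -sumrB.
  apply: le_trans (modulus_sum _ _ _) _.
  apply: (@le_trans _ _ (\sum_(i < L.*2.+1) A * r ^+ L *
     (j1 (i%:Z - L%:Z) + j2 (i%:Z - L%:Z)))).
    apply: ler_sum => i _.
    have i2L : (i <= L.*2)%N by rewrite -ltnS.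
    have pp0 : p != 0 by rewrite expf_neq0.
    set e := r ^+ i + r ^+ (L.*2 - i).
    (* One of j and 2L - j is at most L; the difference is controlled by the smaller
       of the two indices compared. *)
    have dist j : (j <= L.*2)%N ->
        modulus (poch p p L - poch p p j) <= B3 * (r ^+ j + r ^+ (L.*2 - j)).
      move=> j2L; have rj (m : nat) : 0 <= r ^+ m by rewrite exprn_ge0 ?modulus_ge0.
      case: (leqP j L) => jL.
        have := hB3 j (L - j)%N; rewrite subnKC // => /le_trans; apply.
        by apply: ler_wpM2l => //; rewrite lerDl.
      have := hB3 L (j - L)%N; rewrite subnKC ?(ltnW jL) // modulusC => /le_trans; apply.
      apply: ler_wpM2l => //; rewrite -[leLHS]add0r; apply: lerD => //.
      have h : (L.*2 - j <= L)%N by rewrite leq_subLR -addnn leq_add2r ltnW.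
      exact: (ler_wiXn2l (modulus_ge0 _) (ltW p1) h).
    set X := poch p p i; set Y := poch p p (L.*2 - i).
    have X0 : X != 0 := poch_pp_neq0 i; have Y0 : Y != 0 := poch_pp_neq0 _.
    have E : c L * (jterm s a (i%:Z - L%:Z) * qbinom p L.*2 i) - jterm s a (i%:Z - L%:Z) =
      X^-1 * Y^-1 * (poch p p L * (poch p p L - X) + X * (poch p p L - Y)) *
      jterm s a (i%:Z - L%:Z).
      rewrite /c -(qbinom_poch p i2L) -/X -/Y.
      have q0 : qbinom p L.*2 i != 0.
        by apply: contraNneq (poch_pp_neq0 L.*2) => q0; rewrite -(qbinom_poch p i2L) q0 !mul0r.
      by field; rewrite X0 Y0 q0.
    have G1 : r ^+ L * modulus (p ^ (i%:Z - L%:Z)) = r ^+ i.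
      rewrite -(modulusX p) -modulusM exprnP -expfzDr // addrC subrK.
      by rewrite -exprnP (modulusX p).
    have G2 : r ^+ L * modulus (ip ^ (i%:Z - L%:Z)) = r ^+ (L.*2 - i).
      rewrite -(modulusX p) -modulusM exprnP -hip exprz_inv -expfzDr // -(modulusX p).
      rewrite (exprnP p (L.*2 - i)%N).
      by congr (modulus (_ ^ _)); rewrite -(subzn i2L) (_ : L.*2%:Z = L%:Z + L%:Z) ; [ring | rewrite -PoszD addnn].
    have key : modulus (X^-1 * Y^-1 * (poch p p L * (poch p p L - X) + X * (poch p p L - Y)))
        <= A * e.
      rewrite /A modulusM -mulrA; apply: ler_pM; rewrite ?mulr_ge0 ?modulus_ge0 //.
        by rewrite modulusM; apply: ler_pM; rewrite ?modulus_ge0 //; apply: hB2.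
      rewrite mulrnAl mulr2n -mulrA; apply: le_trans (modulus_add _ _) _.
      rewrite 2!modulusM; apply: lerD; apply: ler_pM; rewrite ?modulus_ge0 ?hB1 //.
        exact: dist.
      by rewrite /e [r ^+ i + _]addrC; have := dist _ (leq_subr i L.*2); rewrite subKn.
    have -> : j1 (i%:Z - L%:Z) = modulus (jterm s a (i%:Z - L%:Z)) * modulus (p ^ (i%:Z - L%:Z)).
      by rewrite -hj1 jterm_scale modulusM.
    have -> : j2 (i%:Z - L%:Z) = modulus (jterm s a (i%:Z - L%:Z)) * modulus (ip ^ (i%:Z - L%:Z)).
      by rewrite -hj2 jterm_scale modulusM.
    rewrite E modulusM; move: key G1 G2; rewrite /e.
    move: (modulus (p ^ _)) (modulus (ip ^ _)) => u1 u2 key G1 G2.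
    apply: le_trans (ler_wpM2r (modulus_ge0 _) key) _.
    rewrite -G1 -G2; move: (modulus (jterm _ _ _)) => u3.
    by rewrite le_eqVlt; apply/orP; left; apply/eqP; ring.
  rewrite -mulr_sumr big_split /= -!big_window mulrAC; apply: ler_wpM2r; first by rewrite exprn_ge0 ?modulus_ge0.
  apply: ler_wpM2l => //; apply: lerD.
    by under eq_bigr do rewrite -hj1; apply: hB4.
  by under eq_bigr do rewrite -hj2; apply: hB5.
have h0 : (c L * (poch p a L * poch p (p / a) L) -
    \sum_(k <- window L) jterm s a k @[L --> \oo] --> (0 : C))%classic.
  apply: (cvg0_modulus hB); apply: cvg_geometric; rewrite ger0_norm ?modulus_ge0 //.
have := cvgC_sub (cvgC_mul hc (theta_cvg (a := a) p1)) h0.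
by under eq_fun do rewrite subKr; rewrite subr0.
Qed.
End JacobiSeries.

(** * The three-term relation *)

Section Rearrangement.

Definition square (L : nat) : seq (int * int) :=
  [seq (k, l) | k <- window L, l <- window L].
(** The pairs (k, l) whose coordinates in the basis of the two diagonals lie in a
    window: the first part for k + l even, the second for k + l odd. *)
Definition rotated (L : nat) : seq (int * int) :=
  [seq (i + j, i - j) | i <- window L, j <- window L] ++
  [seq (i + j, i - j + 1) | i <- window L, j <- window L].

Lemma square_uniq L : uniq (square L).
Proof. by apply: allpairs_uniq; rewrite ?window_uniq // => -[a b] [c d]. Qed.

Lemma mem_square L (kl : int * int) :
  (kl \in square L) = (- L%:Z <= kl.1 <= L%:Z) && (- L%:Z <= kl.2 <= L%:Z).
Proof.
case: kl => k l; rewrite -!mem_window /=.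
by apply/allpairsP/andP => [[[a b] /= [ha hb [-> ->]]]|[ha hb]]; last exists (k, l).
Qed.

Lemma rotated_uniq L : uniq (rotated L).
Proof.
rewrite cat_uniq; apply/and3P; split; first 1 last.
- apply/hasPn => -[k l] /allpairsP[[a b] /= [_ _ [-> ->]]].
  apply/negP => h.
  have /allpairsP[[c d] /= [_ _ [h1 h2]]] :
    (a + b, a - b + 1) \in [seq (i + j, i - j) | i <- window L, j <- window L] := h.
  by lia.
- apply: allpairs_uniq; rewrite ?window_uniq // => -[a b] [c d] _ _ /= [h1 h2].
  by congr (_, _); lia.
- apply: allpairs_uniq; rewrite ?window_uniq // => -[a b] [c d] _ _ /= [h1 h2].
  by congr (_, _); lia.
Qed.

Lemma square_sub_rotated L : {subset square L <= rotated L}.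
Proof.
move=> [k l]; rewrite mem_square /= mem_cat => /andP[hk hl].
have [[m hm]|[m hm]] : (exists m, k + l = m * 2) \/ (exists m, k + l = m * 2 + 1).
  have := divz_eq (k + l) 2; have := modz_ge0 (k + l) (isT : 2 != 0 :> int).
  have := ltz_pmod (k + l) (isT : 0 < 2 :> int).
  move: (_ %% _)%Z (_ %/ _)%Z => u v h1 h2 h3.
  have [u0|u1] : u = 0 \/ u = 1 by lia.
    by left; exists v; rewrite h3 u0 addr0.
  by right; exists v; rewrite h3 u1.
- apply/orP; left; apply/allpairsP; exists (m, k - m); rewrite !mem_window /=.
  by split; [lia | lia | congr (_, _); lia].
apply/orP; right; apply/allpairsP; exists (m, k - m); rewrite !mem_window /=.
by split; [lia | lia | congr (_, _); lia].
Qed.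

Lemma rotated_sub_square L : {subset rotated L <= square L.*2.+1}.
Proof.
move=> [k l]; rewrite mem_square /= mem_cat => /orP[] /allpairsP[[a b] /=];
  rewrite !mem_window => -[ha hb [-> ->]]; lia.
Qed.

End Rearrangement.

Section Addition.
Variables (R : realType).
Local Notation C := (R[i] : numFieldType).
Variable s : C.
Hypothesis s0 : s != 0.
Local Notation p := (s ^+ 2).
Hypothesis p1 : modulus p < 1.
Implicit Types (x y : C).

Lemma sqr_expz (z : C) (m : int) : (z ^+ 2) ^ m = z ^ (2 * m).
Proof. by rewrite exprnP exprz_exp. Qed.

Lemma jterm_pair x y k l : x != 0 -> y != 0 ->
  jterm s (x * y) k * jterm s (x / y) l =
  s ^ (k * k - k + (l * l - l)) * ((-1) ^ (k + l) * x ^ (k + l) * y ^ (k - l)).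
Proof.
move=> x0 y0; have n0 : (-1 : C) != 0 by rewrite oppr_eq0 oner_eq0.
rewrite (expfzDr _ _ s0) (expfzDr k l n0) (expfzDr k l x0) (expfzDr k (- l) y0).
have E1 : (- (x * y)) ^ k = (-1) ^ k * x ^ k * y ^ k by rewrite -!expfzMl mulN1r mulNr.
have E2 : (- (x / y)) ^ l = (-1) ^ l * x ^ l * y ^ (- l).
  by rewrite -exprz_inv -!expfzMl mulN1r mulNr.
rewrite /jterm E1 E2; move: (s ^ _) (s ^ _) ((-1) ^ k) ((-1) ^ l) => *.
by ring.
Qed.

Lemma jterm_sqr x i : jterm p (- x ^+ 2) i = s ^ (2 * (i * i - i)) * x ^ (2 * i).
Proof. by rewrite /jterm opprK !sqr_expz. Qed.

Lemma jterm_psqr x i : jterm p (- (p * x ^+ 2)) i = s ^ (2 * (i * i)) * x ^ (2 * i).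
Proof.
have Es : s ^ (2 * (i * i)) = p ^ (i * i - i) * p ^ i.
  by rewrite -expfzDr ?expf_neq0 // subrK sqr_expz.
by rewrite /jterm opprK (expfzMl p) Es -(sqr_expz x) mulrA.
Qed.

Lemma expz_even (m : int) : (-1 : C) ^ (2 * m) = 1.
Proof. by rewrite -sqr_expz sqrrN expr1n exp1rz. Qed.

(** With k = i + j and l = i - j, the exponent k(k-1)/2 + l(l-1)/2 becomes
    i(i-1) + j^2: the variables separate and the nome becomes p^2. *)
Lemma jterm_even x y i j : x != 0 -> y != 0 ->
  jterm s (x * y) (i + j) * jterm s (x / y) (i - j) =
  jterm p (- x ^+ 2) i * jterm p (- (p * y ^+ 2)) j.
Proof.
move=> x0 y0; rewrite jterm_pair // jterm_sqr jterm_psqr.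
rewrite (_ : i + j + (i - j) = 2 * i); last by ring.
rewrite (_ : i + j - (i - j) = 2 * j); last by ring.
rewrite expz_even mul1r mulrACA -(expfzDr _ _ s0).
by congr (s ^ _ * _); ring.
Qed.

(** The other parity class: k = i + j and l = i - j + 1 give the exponent
    i^2 + j(j-1), up to the factor - x / y. *)
Lemma jterm_odd x y i j : x != 0 -> y != 0 ->
  jterm s (x * y) (i + j) * jterm s (x / y) (i - j + 1) =
  - (x / y) * (jterm p (- (p * x ^+ 2)) i * jterm p (- y ^+ 2) j).
Proof.
move=> x0 y0; have n0 : (-1 : C) != 0 by rewrite oppr_eq0 oner_eq0.
rewrite jterm_pair // jterm_sqr jterm_psqr.
rewrite (_ : i + j + (i - j + 1) = 2 * i + 1); last by ring.
rewrite (_ : i + j - (i - j + 1) = 2 * j - 1); last by ring.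
rewrite (expfzDr (2 * i) 1 n0) (expfzDr (2 * i) 1 x0) (expfzDr (2 * j) (-1) y0).
rewrite expz_even exprN1 !expr1z.
rewrite (_ : s ^ _ = s ^ (2 * (i * i)) * s ^ (2 * (j * j - j))); first by ring.
by rewrite -(expfzDr _ _ s0); congr (s ^ _); ring.
Qed.

Lemma p_neq0 : p != 0. Proof. by rewrite expf_neq0. Qed.

Lemma p2_lt1 : modulus (p ^+ 2) < 1.
Proof. by rewrite (modulusX p) expr_lt1 ?modulus_ge0. Qed.

(** Both sides are sums of the same double series, over squares on the left and
    over rotated squares on the right.  A rotated square lies between two squares,
    so the difference of the partial sums is bounded by the mass between these
    squares, which tends to 0. *)
Lemma theta_mul_add x y l l2 : x != 0 -> y != 0 ->
  (poch p p M @[M --> \oo] --> (l : C))%classic ->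
  (poch (p ^+ 2) (p ^+ 2) M @[M --> \oo] --> (l2 : C))%classic ->
  l ^+ 2 * (theta p (x * y) * theta p (x / y)) =
  l2 ^+ 2 * (theta (p ^+ 2) (- x ^+ 2) * theta (p ^+ 2) (- (p * y ^+ 2)) -
   x / y * (theta (p ^+ 2) (- (p * x ^+ 2)) * theta (p ^+ 2) (- y ^+ 2))).
Proof.
move=> x0 y0 hl hl2.
have xy0 : x * y != 0 by rewrite mulf_neq0.
have xVy0 : x / y != 0 by rewrite mulf_neq0 ?invr_neq0.
have nx0 : - x ^+ 2 != 0 by rewrite oppr_eq0 expf_neq0.
have ny0 : - y ^+ 2 != 0 by rewrite oppr_eq0 expf_neq0.
have npx0 : - (p * x ^+ 2) != 0 by rewrite oppr_eq0 mulf_neq0 ?p_neq0 ?expf_neq0.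
have npy0 : - (p * y ^+ 2) != 0 by rewrite oppr_eq0 mulf_neq0 ?p_neq0 ?expf_neq0.
pose J a L := \sum_(k <- window L) jterm s a k.
pose J2 a L := \sum_(k <- window L) jterm p a k.
pose tau (kl : int * int) := jterm s (x * y) kl.1 * jterm s (x / y) kl.2.
pose mass L := jmass s (x * y) L * jmass s (x / y) L.
have sqE L : J (x * y) L * J (x / y) L = \sum_(kl <- square L) tau kl.
  by rewrite /J big_distrl big_allpairs /=; apply: eq_bigr => k _; rewrite big_distrr.
have massE L : mass L = \sum_(kl <- square L) modulus (tau kl).
  rewrite /mass /jmass big_distrl big_allpairs /=; apply: eq_bigr => k _.
  by rewrite big_distrr; apply: eq_bigr => m _; rewrite /tau modulusM.
have rotE L : J2 (- x ^+ 2) L * J2 (- (p * y ^+ 2)) L -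
    x / y * (J2 (- (p * x ^+ 2)) L * J2 (- y ^+ 2) L) = \sum_(kl <- rotated L) tau kl.
  rewrite big_cat !big_allpairs_dep /=; congr (_ + _).
    rewrite /J2 big_distrl; apply: eq_bigr => i _.
    by rewrite big_distrr; apply: eq_bigr => j _; rewrite /tau jterm_even.
  rewrite -(mulNr (x / y)) /J2 big_distrl big_distrr /=; apply: eq_bigr => i _.
  by rewrite !big_distrr; apply: eq_bigr => j _; rewrite /tau jterm_odd.
have hJ a : a != 0 -> (J a L @[L --> \oo] --> (l * theta p a : C))%classic.
  by move=> a0; exact: (jsum_cvg s0 p1 a0 hl).
have hJ2 a : a != 0 -> (J2 a L @[L --> \oo] --> (l2 * theta (p ^+ 2) a : C))%classic.
  by move=> a0; exact: (jsum_cvg p_neq0 p2_lt1 a0 hl2).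
have hQ := cvgC_mul (hJ _ xy0) (hJ _ xVy0).
have hR := cvgC_sub (cvgC_mul (hJ2 _ nx0) (hJ2 _ npy0))
  (cvgC_mul (@cvgC_cst _ (x / y)) (cvgC_mul (hJ2 _ npx0) (hJ2 _ ny0))).
have [m1 hm1] := jmass_cvg s0 p1 xy0; have [m2 hm2] := jmass_cvg s0 p1 xVy0.
have hm : (mass L @[L --> \oo] --> m1 * m2)%classic by apply: cvgM.
have h0 : (J2 (- x ^+ 2) L * J2 (- (p * y ^+ 2)) L -
    x / y * (J2 (- (p * x ^+ 2)) L * J2 (- y ^+ 2) L) - J (x * y) L * J (x / y) L
    @[L --> \oo] --> (0 : C))%classic.
  apply: (@cvg0_modulus _ _ (fun L => mass L.*2.+1 - mass L)) => [L|].
    rewrite rotE sqE !massE; apply: modulus_sum_diff; rewrite ?square_uniq ?rotated_uniq //.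
      exact: square_sub_rotated.
    exact: rotated_sub_square.
  rewrite -[X in (_ --> X)%classic](subrr (m1 * m2)); apply: cvgB => //.
  apply: (cvg_comp _ _ _ hm).
  move=> A [n _ hA]; exists n => // m /= nm; apply: hA => /=.
  by rewrite (leq_trans nm) // -addnn -addnS leq_addr.
have := cvgC_unique h0 (cvgC_sub hR hQ) => /eqP; rewrite eq_sym subr_eq0 => /eqP E.
transitivity (l * theta p (x * y) * (l * theta p (x / y))); first by ring.
rewrite -E; move: (theta _ (- _)) (theta _ (- _)) (theta _ (- _)) (theta _ (- _)) (x / y) => *.
by ring.
Qed.

End Addition.

(** The Pluecker relation among the four vectors (f, g) at w/t, b/t, e1/t, e2/t. *)
Lemma three_term_of_rank2 (K : fieldType) (th f g : K -> K) (k : K) :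
  k != 0 ->
  (forall x y, x != 0 -> y != 0 ->
     k * (th (x * y) * th (x / y)) = x * (f x * g y - g x * f y)) ->
  forall t w b e1 e2 : K, t != 0 -> w != 0 -> b != 0 -> e1 != 0 -> e2 != 0 ->
  th (w / b) * th (w * b / t ^+ 2) * (th (e1 / e2) * th (e1 * e2 / t ^+ 2)) =
  th (w / e2) * th (w * e2 / t ^+ 2) * (th (e1 / b) * th (e1 * b / t ^+ 2)) +
  e1 / b * (th (w / e1) * th (w * e1 / t ^+ 2)) * (th (b / e2) * th (b * e2 / t ^+ 2)).
Proof.
move=> k0 hfg t w b e1 e2 t0 w0 b0 e10 e20.
have H u v : u != 0 -> v != 0 -> th (u / v) * th (u * v / t ^+ 2) =
    k^-1 * (u / t * (f (u / t) * g (v / t) - g (u / t) * f (v / t))).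
  move=> u0 v0; rewrite -hfg ?mulf_neq0 ?invr_neq0 // mulKf // mulrC.
  by congr (th _ * th _); field; rewrite t0 // v0.
by rewrite !H //; field; rewrite t0 b0 k0.
Qed.

Section ThreeTerm.
Variables (R : realType).
Local Notation C := (R[i] : numFieldType).
Variable p : C.
Hypothesis p1 : modulus p < 1.

Lemma theta_p0 (a : C) : theta (0 : C) a = 1 - a.
Proof.
have m0 : modulus (0 : C) < 1 by rewrite modulus0.
apply: (cvgC_unique (theta_cvg m0)); apply: cvg_near_cst; exists 1%N => // -[|M] // _.
have h z : poch 0 z M.+1 = 1 - z :> C.
  rewrite /poch big_ord_recl expr0 mulr1 big1 ?mulr1 // => i _.
  by rewrite lift0 expr0n mulr0 subr0.
by rewrite !h mul0r subr0 mulr1.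
Qed.

(** The rearranged double series, divided by the nonzero limit of (p; p)_M; the
    series are available for p <> 0 only. *)
Lemma theta_rank2 : p != 0 -> exists (k : C) (f g : C -> C), k != 0 /\
  forall x y : C, x != 0 -> y != 0 ->
  k * (theta p (x * y) * theta p (x / y)) = x * (f x * g y - g x * f y).
Proof.
move=> p0; pose s : C := sqrtc p.
have sE : s ^+ 2 = p by rewrite /s sqr_sqrtc.
have s0 : s != 0 by apply: contra_neq p0 => s00; rewrite -sE s00 expr0n.
have p1' : modulus (s ^+ 2) < 1 by rewrite sE.
have [l hl] := poch_cvg (s ^+ 2) p1'.
have [l2 hl2] := poch_cvg ((s ^+ 2) ^+ 2) (p2_lt1 p1').
have l0 := poch_cvg_neq0 p1' (pp_neq1 s0 p1') hl.
exists (l ^+ 2), (fun x => l2 ^+ 2 * (theta (p ^+ 2) (- x ^+ 2) / x)),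
  (fun x => theta (p ^+ 2) (- (p * x ^+ 2))); split; first exact: expf_neq0.
move=> x y x0 y0; have := theta_mul_add s0 p1' x0 y0 hl hl2; rewrite sE => ->.
move: (theta _ _) (theta _ _) (theta _ _) (theta _ _) => t1 t2 t3 t4.
by field; rewrite x0 y0.
Qed.

(** For p = 0, theta z = 1 - z and the relation is a polynomial identity. *)
Lemma theta_three_term (c w b e1 e2 : C) :
  c != 0 -> w != 0 -> b != 0 -> e1 != 0 -> e2 != 0 ->
  theta p (w / b) * theta p (w * b / c) * (theta p (e1 / e2) * theta p (e1 * e2 / c)) =
  theta p (w / e2) * theta p (w * e2 / c) * (theta p (e1 / b) * theta p (e1 * b / c)) +
  e1 / b * (theta p (w / e1) * theta p (w * e1 / c)) * (theta p (b / e2) * theta p (b * e2 / c)).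
Proof.
move=> c0 w0 b0 e10 e20.
have [p0|p0] := eqVneq p 0.
  by rewrite p0 !theta_p0; field; rewrite c0 b0 e10 e20.
have [k [f [g [k0 hfg]]]] := theta_rank2 p0.
pose t : C := sqrtc c.
have tE : t ^+ 2 = c by rewrite /t sqr_sqrtc.
have t0 : t != 0 by apply: contra_neq c0 => t00; rewrite -tE t00 expr0n.
by have := three_term_of_rank2 k0 hfg t0 w0 b0 e10 e20; rewrite tE.
Qed.
End ThreeTerm.

(** * Interpolation by theta functions *)

(** What the combinatorial part needs to know about theta.  The closure of the
    zeros under division stands for the description of the zeros; it excludes that
    two prescribed quantities vanish simultaneously when their quotient is not a
    zero. *)
Record theta_like (K : fieldType) (th : K -> K) : Prop := ThetaLike {
  th_one : th 1 = 0;
  th_inv : forall z, z != 0 -> th z^-1 = - (z^-1 * th z);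
  th_zero_div : forall s t, s != 0 -> t != 0 ->
    th s = 0 -> th t = 0 -> th (s / t) = 0;
  th_three_term : forall c w b e1 e2,
    c != 0 -> w != 0 -> b != 0 -> e1 != 0 -> e2 != 0 ->
    th (w / b) * th (w * b / c) * (th (e1 / e2) * th (e1 * e2 / c)) =
    th (w / e2) * th (w * e2 / c) * (th (e1 / b) * th (e1 * b / c)) +
    e1 / b * (th (w / e1) * th (w * e1 / c)) * (th (b / e2) * th (b * e2 / c))
}.

Section Interpolation.
Variables (K : fieldType) (th : K -> K).
Hypothesis thP : theta_like th.

Definition thprod (bs : seq K) (z : K) : K := \prod_(b <- bs) th (z / b).

Lemma th_flip y z : y != 0 -> z != 0 -> th (y / z) = - (y / z * th (z / y)).
Proof.
move=> y0 z0; have h : z / y != 0 by rewrite mulf_neq0 ?invr_neq0.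
by have := th_inv thP h; rewrite invf_div.
Qed.

Lemma th_neq0_sym y z : y != 0 -> z != 0 -> th (y / z) != 0 -> th (z / y) != 0.
Proof. by move=> y0 z0; rewrite th_flip // oppr_eq0 mulf_eq0 negb_or => /andP[]. Qed.

Section Nodes.
Variables (I : finType) (v : I -> K).
Hypothesis v0 : forall i, v i != 0.

Definition nodeprod (A : {set I}) : K := \prod_(i in A) v i.

(** The analogue of the Lagrange basis polynomials. *)
Definition cardinal (A : {set I}) (z : K) (i : I) : K :=
  \prod_(j in A :\ i) (th (z / v j) / th (v i / v j)).

(** Interpolation of the product of th (z / b), b in bs, at the nodes v i, i in A.
    In contrast with polynomials, the product of the zeros of a theta polynomial of
    given degree is prescribed, hence the additional factor on each side. *)
Definition lagrange_formula (A : {set I}) (bs : seq K) (z : K) : Prop :=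
  th (nodeprod A / \prod_(b <- bs) b) * thprod bs z =
  \sum_(i in A) thprod bs (v i) *
     th (z * nodeprod A / (\prod_(b <- bs) b * v i)) * cardinal A z i.

Lemma nodeprod_neq0 A : nodeprod A != 0.
Proof. by apply/prodf_neq0. Qed.

Lemma lagrange_two (i j : I) b1 b2 z : i != j -> th (v i / v j) != 0 ->
  b1 != 0 -> b2 != 0 -> z != 0 -> lagrange_formula [set i; j] [:: b1; b2] z.
Proof.
move=> ij vij b10 b20 z0; have vi := v0 i; have vj := v0 j.
rewrite /lagrange_formula /thprod /nodeprod /cardinal !big_setU1 ?inE //= !big_set1.
have -> : [set i; j] :\ i = [set j].
  by apply/setP => k; rewrite !inE; case: eqVneq => [->|]; rewrite ?(negbTE ij).
have -> : [set i; j] :\ j = [set i].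
  by apply/setP => k; rewrite !inE; case: eqVneq => [->|]; rewrite ?orbF // eq_sym (negbTE ij).
rewrite !big_set1 !big_cons !big_nil !mulr1.
have c0 : b1 * b2 != 0 by rewrite mulf_neq0.
have T := th_three_term thP c0 z0 b10 vi vj.
have Eb w : w / b2 = w * b1 / (b1 * b2) by field; rewrite b10 b20.
have Ei : z * (v i * v j) / (b1 * b2 * v i) = z * v j / (b1 * b2) by field; rewrite b10 b20 vi.
have Ej : z * (v i * v j) / (b1 * b2 * v j) = z * v i / (b1 * b2) by field; rewrite b10 b20 vj.
have Fj : th (b1 / v j) = - (b1 / v j * th (v j / b1)) by rewrite th_flip.
have Fij : th (v j / v i) = - (v j / v i * th (v i / v j)) by rewrite th_flip.
rewrite !Eb Ei Ej Fij; rewrite Fj [b1 * v j]mulrC in T.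
apply: (mulIf vij).
transitivity (th (z / b1) * th (z * b1 / (b1 * b2)) *
  (th (v i / v j) * th (v i * v j / (b1 * b2)))); first by ring.
by rewrite T; field; rewrite vi vij vj b10 oppr_eq0 mulf_neq0.
Qed.

Lemma cardinalD1 (A : {set I}) z k i : k \in A -> i != k ->
  cardinal A z i = th (z / v k) / th (v i / v k) * cardinal (A :\ k) z i.
Proof.
move=> kA ik; rewrite /cardinal (bigD1 k) ?inE /=; last by rewrite kA eq_sym ik.
by congr (_ * _); apply: eq_bigl => j; rewrite !inE -andbA; congr (_ && _); rewrite andbC.
Qed.

Lemma thprod_at_node k : th (v k / v k) = 0.
Proof. by rewrite divff // (th_one thP). Qed.

(** Induction on the number of nodes, after the cases of at most two nodes.  Keep
    c = b1 * b2 fixed and replace (b1, b2) by (beta, c / beta).  The difference F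
    of the two sides is a combination of the functions
    th (w / beta) * th (w * beta / c) of beta, hence satisfies the three-term
    relation in beta.  At a node beta = v k the factor th (z / v k) splits off and
    F (v k) = 0 is the formula for the other nodes.  The three-term relation
    with two nodes v i, v j then gives F b1 = 0 unless th (v i * v j / c) = 0; this
    cannot happen for two pairs with one common node, and there are three nodes. *)
Lemma lagrange (A : {set I}) bs z :
  (forall i j, i \in A -> j \in A -> i != j -> th (v i / v j) != 0) ->
  #|A| = size bs -> all (fun b => b != 0) bs -> z != 0 -> lagrange_formula A bs z.
Proof.
elim: {A}#|A| {-2}A (erefl #|A|) bs => [|n IH] A cardA bs dist szA bs0 z0.
  rewrite cardA in szA; move/eqP: cardA; rewrite cards_eq0 => /eqP ->.
  case: bs szA bs0 => // _ _; rewrite /lagrange_formula /nodeprod !big_set0 big_nil.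
  by rewrite divr1 (th_one thP) mul0r.
case: n IH cardA => [|[|n]] IH cardA.
- have /cards1P[i Ai] : #|A| == 1%N by rewrite cardA.
  case: bs szA bs0 => [|b [|? ?]]; rewrite cardA // => _ /andP[b0 _]; rewrite Ai.
  rewrite /lagrange_formula /nodeprod /cardinal /thprod !big_set1 !big_cons !big_nil !mulr1.
  rewrite finset.setDv big_set0 mulr1; congr (_ * th _); by field; rewrite b0 v0.
- have /cards2P[i [j [ij Aij]]] : #|A| == 2%N by rewrite cardA.
  case: bs szA bs0 => [|b1 [|b2 [|? ?]]]; rewrite cardA // => _ /and3P[b10 b20 _]; rewrite Aij.
  by apply: lagrange_two => //; apply: dist => //; rewrite Aij !inE eqxx ?orbT.
case: bs szA bs0 => [|b1 [|b2 bs]] /= szA; rewrite ?cardA // in szA * => /and3P[b10 b20 bs0].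
set c := b1 * b2; have c0 : c != 0 by rewrite mulf_neq0.
set B0 := \prod_(b <- bs) b.
have B00 : B0 != 0 by rewrite prodf_seq_neq0.
pose phi w b := th (w / b) * th (w * b / c).
pose L0 := th (nodeprod A / (c * B0)) * thprod bs z.
pose L i := thprod bs (v i) * th (z * nodeprod A / (c * B0 * v i)) * cardinal A z i.
pose F b := L0 * phi z b - \sum_(i in A) L i * phi (v i) b.
have H3 e1 e2 b : e1 != 0 -> e2 != 0 -> b != 0 ->
    F b * (th (e1 / e2) * th (e1 * e2 / c)) =
    F e2 * (th (e1 / b) * th (e1 * b / c)) + e1 / b * F e1 * (th (b / e2) * th (b * e2 / c)).
  move=> e10 e20 b0.
  have T w : w != 0 -> phi w b * (th (e1 / e2) * th (e1 * e2 / c)) =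
      phi w e2 * (th (e1 / b) * th (e1 * b / c)) +
      e1 / b * phi w e1 * (th (b / e2) * th (b * e2 / c)).
    by move=> w0; apply: (th_three_term thP).
  have ES : (\sum_(i in A) L i * phi (v i) b) * (th (e1 / e2) * th (e1 * e2 / c)) =
      (\sum_(i in A) L i * phi (v i) e2) * (th (e1 / b) * th (e1 * b / c)) +
      e1 / b * (\sum_(i in A) L i * phi (v i) e1) * (th (b / e2) * th (b * e2 / c)).
    rewrite mulr_sumr !mulr_suml -big_split; apply: eq_bigr => i _.
    by rewrite -mulrA T //=; ring.
  by rewrite /F mulrBl ES -(mulrA L0) (T z z0); ring.
have Fz k : k \in A -> F (v k) = 0.
  move=> kA.
  have cA : #|A :\ k| = n.+2 by move: cardA; rewrite (cardsD1 k) kA => -[].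
  have bs0' : all (fun b => b != 0) (c / v k :: bs).
    by rewrite /= bs0 mulf_neq0 ?invr_neq0.
  have dist' i j : i \in A :\ k -> j \in A :\ k -> i != j -> th (v i / v j) != 0.
    by rewrite !inE => /andP[_ iA] /andP[_ jA]; apply: dist.
  have sz' : #|A :\ k| = size (c / v k :: bs) by rewrite cA -[RHS]/(size bs).+1; case: szA => <-.
  have := IH (A :\ k) cA (c / v k :: bs) dist' sz' bs0' z0.
  have vk := v0 k; have VA : nodeprod A = v k * nodeprod (A :\ k) by rewrite /nodeprod (big_setD1 k).
  have E1 : nodeprod (A :\ k) / (c / v k * B0) = nodeprod A / (c * B0).
    by rewrite VA; field; rewrite vk c0 B00.
  have E2 i : z * nodeprod (A :\ k) / (c / v k * B0 * v i) = z * nodeprod A / (c * B0 * v i).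
    by rewrite VA; field; rewrite vk c0 B00 v0.
  have E3 w : thprod (c / v k :: bs) w = th (w * v k / c) * thprod bs w.
    by rewrite /thprod big_cons; congr (th _ * _); field; rewrite vk c0.
  rewrite /lagrange_formula big_cons -/B0 E1 E3 => E.
  have phk : phi (v k) (v k) = 0 by rewrite /phi thprod_at_node mul0r.
  rewrite /F (big_setD1 k) //= phk mulr0 add0r.
  apply/eqP; rewrite subr_eq0; apply/eqP.
  transitivity (th (z / v k) * (th (nodeprod A / (c * B0)) * (th (z * v k / c) * thprod bs z))).
    by rewrite /L0 /phi; ring.
  rewrite E mulr_sumr; apply: eq_bigr => i; rewrite !inE => /andP[ik iA].
  rewrite E2 E3 /L (cardinalD1 _ kA ik) /phi.
  have d : th (v i / v k) != 0 by apply: dist.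
  by field.
(* H3 at the nodes v i and v j. *)
have good i j : i \in A -> j \in A -> th (v i / v j) != 0 -> th (v i * v j / c) != 0 -> F b1 = 0.
  move=> iA jA d1 d2; have := H3 _ _ _ (v0 i) (v0 j) b10.
  rewrite !Fz // mulr0 !mul0r addr0 => /eqP.
  by rewrite mulf_eq0 mulf_eq0 (negbTE d1) (negbTE d2) !orbF => /eqP.
have FE : F b1 = 0.
  have [i iA] : exists i, i \in A by apply/set0Pn; rewrite -card_gt0 cardA.
  have cA : #|A :\ i| = n.+2 by move: cardA; rewrite (cardsD1 i) iA => -[].
  have [j jA] : exists j, j \in A :\ i by apply/set0Pn; rewrite -card_gt0 cA.
  have cA' : #|A :\ i :\ j| = n.+1 by move: cA; rewrite (cardsD1 j) jA => -[].
  have [k kA] : exists k, k \in A :\ i :\ j by apply/set0Pn; rewrite -card_gt0 cA'.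
  move: jA kA; rewrite !inE => /andP[ji jA] /andP[kj /andP[ki kA]].
  have [d|d] := eqVneq (th (v i * v j / c)) 0; last first.
    by apply: (good i j) => //; apply: dist => //; rewrite eq_sym.
  apply: (good i k) => //; first by apply: dist => //; rewrite eq_sym.
  have vi := v0 i; have vj := v0 j; have vk := v0 k.
  apply/eqP => d'; have := th_zero_div thP _ _ d d'.
  rewrite !mulf_neq0 ?invr_neq0 // => /(_ isT isT).
  have -> : v i * v j / c / (v i * v k / c) = v j / v k by field; rewrite vi vk c0.
  by apply/eqP/dist => //; rewrite eq_sym.
have ph w : th (w / b1) * th (w / b2) = phi w b1.
  by rewrite /phi; congr (_ * th _); rewrite /c; field; rewrite b10 b20.
rewrite /lagrange_formula /thprod !big_cons -/B0 (mulrA b1 b2 B0) -/c.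
move/eqP: FE; rewrite subr_eq0 => /eqP; rewrite /L0 => E.
rewrite [LHS](_ : _ = th (nodeprod A / (c * B0)) * thprod bs z * phi z b1); last first.
  by rewrite -ph /thprod; ring.
rewrite E; apply: eq_bigr => i _.
by rewrite ?big_cons -?/B0 -?/c /L -ph /thprod; ring.
Qed.
End Nodes.
End Interpolation.

Section ThetaFunctions.
Variables (K : fieldType) (th : K -> K).
Hypothesis thP : theta_like th.

(** Being interpolated with m nodes and with the constant t (the product of the
    y's for a product of factors th (y * z)).  Unlike being such a product, this
    property is preserved by linear combinations. *)
Definition theta_fun (m : nat) (t : K) (f : K -> K) : Prop :=
  forall (I : finType) (v : I -> K) (A : {set I}) (z : K),
  (forall i, v i != 0) ->
  (forall i j, i \in A -> j \in A -> i != j -> th (v i / v j) != 0) ->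
  #|A| = m -> z != 0 ->
  th (t * nodeprod v A) * f z =
  \sum_(i in A) f (v i) * th (t * z * nodeprod v A / v i) * cardinal th v A z i.

Lemma theta_fun_ext m t f g : (forall z, z != 0 -> f z = g z) ->
  theta_fun m t f -> theta_fun m t g.
Proof.
move=> fg hf I v A z v0 d cA z0; rewrite -fg // hf //.
by apply: eq_bigr => i _; rewrite fg.
Qed.

Lemma theta_fun_scale m t c f : theta_fun m t f -> theta_fun m t (fun z => c * f z).
Proof.
move=> hf I v A z v0 d cA z0; rewrite mulrCA hf // mulr_sumr.
by apply: eq_bigr => i _; rewrite !mulrA.
Qed.

Lemma theta_fun_sum m t (J : Type) (r : seq J) (P : pred J) (F : J -> K -> K) :
  (forall j, P j -> theta_fun m t (F j)) ->
  theta_fun m t (fun z => \sum_(j <- r | P j) F j z).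
Proof.
move=> hF I v A z v0 d cA z0.
transitivity (\sum_(j <- r | P j) th (t * nodeprod v A) * F j z); first by rewrite mulr_sumr.
under eq_bigr => j Pj do rewrite (hF j Pj I v A z v0 d cA z0).
rewrite exchange_big; apply: eq_bigr => i _.
by rewrite !mulr_suml.
Qed.

Lemma theta_fun_sub m t f g : theta_fun m t f -> theta_fun m t g ->
  theta_fun m t (fun z => f z - g z).
Proof.
move=> hf hg I v A z v0 d cA z0; rewrite mulrBr hf // hg // -sumrB.
by apply: eq_bigr => i _; rewrite !mulrBl.
Qed.

Lemma theta_fun_prod ys : all (fun y => y != 0) ys ->
  theta_fun (size ys) (\prod_(y <- ys) y) (fun z => \prod_(y <- ys) th (y * z)).
Proof.
move=> ys0 I v A z v0 d cA z0.
have := @lagrange _ _ thP _ _ v0 A [seq y^-1 | y <- ys] z d.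
rewrite size_map all_map => /(_ cA _ z0).
rewrite /lagrange_formula /thprod !big_map => H.
have {}H := H (sub_all (fun y (y0 : y != 0) => invr_neq0 y0) ys0).
have E w : \prod_(j <- ys) th (w / j^-1) = \prod_(y <- ys) th (y * w).
  by apply: eq_bigr => y _; rewrite invrK mulrC.
rewrite !E prodfV invrK [X in th X * _]mulrC in H; rewrite H.
by apply: eq_bigr => i _; rewrite big_map E invfM invrK; congr (_ * th _ * _); ring.
Qed.

(** Interpolation at m of the m + 1 zeros gives f z = 0 unless the factor
    th (t * product of the nodes) vanishes.  Leaving out the first or the last zero
    changes the argument of this factor by the quotient of these two points, which
    is not a zero of th; so one of the two choices works. *)
Lemma theta_fun_eq0 m t f (v : 'I_m.+2 -> K) z :
  theta_fun m.+1 t f -> t != 0 -> (forall i, v i != 0) ->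
  (forall i j, i != j -> th (v i / v j) != 0) ->
  (forall i, f (v i) = 0) -> z != 0 -> f z = 0.
Proof.
move=> hf t0 v0 d fv z0.
pose A i : {set 'I_m.+2} := [set~ i].
have cA i : #|A i| = m.+1 by rewrite cardsC1 card_ord.
have H i : th (t * nodeprod v (A i)) * f z = 0.
  rewrite (hf _ v) //; last by move=> j k _ _; apply: d.
  by apply: big1 => j _; rewrite fv !mul0r.
have V i : nodeprod v (A i) = nodeprod v [set: _] / v i.
  rewrite /nodeprod [in RHS](big_setD1 i) ?inE // mulrAC divff // mul1r.
  by apply: eq_bigl => j; rewrite !inE ?andbT.
have n0 : nodeprod v [set: 'I_m.+2] != 0 by apply: nodeprod_neq0.
have := H ord0; have := H ord_max => /eqP; rewrite mulf_eq0 => /orP[/eqP h1|/eqP //].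
move=> /eqP; rewrite mulf_eq0 => /orP[/eqP h2|/eqP //].
have := th_zero_div thP _ _ h1 h2; rewrite !mulf_neq0 ?nodeprod_neq0 // => /(_ isT isT).
rewrite !V; have a0 := v0 ord0; have b0 := v0 ord_max.
have -> : t * (nodeprod v [set: 'I_m.+2] / v ord_max) / (t * (nodeprod v [set: 'I_m.+2] / v ord0))
  = v ord0 / v ord_max by field; rewrite t0 n0 a0 b0.
by move/eqP; rewrite (negbTE (d _ _ _)).
Qed.

Lemma theta_fun_zeros M t g z (w : nat -> K) : theta_fun (M + M) t g -> (0 < M)%N -> t != 0 ->
  (forall i, w i != 0) -> (forall i j, i != j -> th (w i / w j) != 0) ->
  (forall i, g (w i) = 0) -> z != 0 -> g z = 0.
Proof.
case: M => // M; rewrite addSn addnS => hg _ t0 w0 ww gw.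
by apply: (theta_fun_eq0 hg (v := fun i => w i)) => // i j; apply: ww.
Qed.

(** Products of m factors th (y * z) with t the product of the y's, up to a
    constant. *)
Definition theta_monomial (m : nat) (t : K) (f : K -> K) : Prop :=
  exists c ys, [/\ size ys = m, \prod_(y <- ys) y = t, all (fun y => y != 0) ys &
    forall z, z != 0 -> f z = c * \prod_(y <- ys) th (y * z)].

Lemma theta_monomial_fun m t f : theta_monomial m t f -> theta_fun m t f.
Proof.
move=> [c [ys [<- <- ys0 fE]]].
apply: (@theta_fun_ext _ _ (fun z => c * \prod_(y <- ys) th (y * z))).
  by move=> z /fE.
by apply: theta_fun_scale; apply: theta_fun_prod.
Qed.

Lemma theta_monomial_ext m t m' t' f g :
  (forall z, z != 0 -> f z = g z) -> m = m' -> t = t' ->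
  theta_monomial m t f -> theta_monomial m' t' g.
Proof.
move=> fg <- <- [c [ys [h1 h2 h3 h4]]]; exists c, ys; split=> // z z0.
by rewrite -fg // h4.
Qed.

Lemma theta_monomial_cst c : theta_monomial 0 1 (fun=> c).
Proof. by exists c, [::]; split=> //; rewrite ?big_nil // => z _; rewrite big_nil mulr1. Qed.

Lemma theta_monomial_mul m t f m' t' g : theta_monomial m t f ->
  theta_monomial m' t' g -> theta_monomial (m + m') (t * t') (fun z => f z * g z).
Proof.
move=> [c [ys [<- <- h3 h4]]] [c' [ys' [<- <- h3' h4']]].
exists (c * c'), (ys ++ ys'); split; rewrite ?size_cat ?big_cat ?all_cat ?h3 //.
by move=> z z0; rewrite h4 // h4' // big_cat /=; ring.
Qed.

Lemma theta_monomial_th y : y != 0 -> theta_monomial 1 y (fun z => th (y * z)).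
Proof.
move=> y0; exists 1, [:: y]; split; rewrite ?big_cons ?big_nil ?mulr1 //= ?y0 //.
by move=> z _; rewrite big_cons big_nil mulr1 mul1r.
Qed.

Lemma theta_monomial_thV y : y != 0 -> theta_monomial 1 y^-1 (fun z => z * th (y / z)).
Proof.
move=> y0; exists (- y), [:: y^-1]; split; rewrite ?big_cons ?big_nil ?mulr1 //= ?invr_eq0 ?y0 //.
move=> z z0; rewrite big_cons big_nil mulr1 (th_flip thP) // [y^-1 * z]mulrC.
by field.
Qed.

Lemma theta_monomial_prod (J : Type) (r : seq J) (P : pred J) (m : J -> nat) (t : J -> K) (f : J -> K -> K) :
  (forall j, P j -> theta_monomial (m j) (t j) (f j)) ->
  theta_monomial (\sum_(j <- r | P j) m j)%N (\prod_(j <- r | P j) t j)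
    (fun z => \prod_(j <- r | P j) f j z).
Proof.
move=> h; elim: r => [|j r IH].
  by apply: theta_monomial_ext (theta_monomial_cst 1); rewrite ?big_nil // => z _; rewrite big_nil.
case Pj: (P j); last first.
  by apply: theta_monomial_ext IH; rewrite ?big_cons ?Pj // => z _; rewrite big_cons Pj.
apply: theta_monomial_ext (theta_monomial_mul (h _ Pj) IH).
- by move=> z _; rewrite big_cons Pj.
- by rewrite big_cons Pj.
- by rewrite big_cons Pj.
Qed.
End ThetaFunctions.

(** * A partial fraction expansion *)

Section NodeExpansion.
Variables (K : fieldType) (th : K -> K).
Hypothesis thP : theta_like th.
Variable n : nat.
Implicit Types (X Y : 'I_n -> K) (S : {set 'I_n}).

(** The coefficient of the expansion below at the node Y r; it does not involve
    X, Z1 and W1, so that different instances share it. *)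
Definition node_weight Y (Z2 W2 : K) (r : 'I_n) : K :=
  (\prod_j th (Y j / Z2)) * th (Y r / W2) /
  (th (Z2 / Y r) * \prod_(j | j != r) th (Y j / Y r)).

(** Lagrange interpolation at the nodes Z2^-1 and (Y r)^-1 for r in S, evaluated at
    Z1^-1, of the product with zeros at W1^-1 and (X s)^-1.  The balancing condition
    brings the additional theta factors into the form th (_ / W2).  Indices outside S,
    where X r = Y r, contribute equal factors to both sides; with them the weights
    do not depend on S. *)
Lemma node_expansion S X Y Z1 Z2 W1 W2 :
  (forall r, X r != 0) -> (forall r, Y r != 0) -> Z1 != 0 -> Z2 != 0 -> W1 != 0 -> W2 != 0 ->
  (forall r, r \notin S -> X r = Y r) ->
  Z1 * Z2 * \prod_r Y r = W1 * W2 * \prod_r X r ->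
  (forall r s, r != s -> th (Y r / Y s) != 0) -> (forall r, th (Y r / Z2) != 0) ->
  th (Z1 / W2) * th (W1 / Z1) * (\prod_(s in S) th (X s / Z1)) * (\prod_j th (Y j / Z2)) =
  th (Z2 / W2) * th (W1 / Z2) * (\prod_s th (X s / Z2)) * (\prod_(j in S) th (Y j / Z1)) +
  \sum_(r in S) node_weight Y Z2 W2 r * th (Z2 / Z1) * th (W1 / Y r) *
     (\prod_s th (X s / Y r)) * (\prod_(j in S :\ r) th (Y j / Z1)).
Proof.
move=> X0 Y0 z1 z2 w1 w2 XY bal dY dZ.
pose v (o : option 'I_n) : K := if o is Some r then (Y r)^-1 else Z2^-1.
have v0 o : v o != 0 by case: o => [r|]; rewrite invr_eq0.
(* The index None stands for the node Z2^-1. *)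
pose A : {set option 'I_n} := None |: [set Some r | r in S].
have NA : None \notin [set Some r | r in S] by apply/imsetP => -[].
have SI : {in S &, injective (@Some 'I_n)} by move=> r s _ _ [].
have bigA (V : Type) (idx : V) (op : Monoid.com_law idx) (F : option 'I_n -> V) :
    \big[op/idx]_(o in A) F o = op (F None) (\big[op/idx]_(r in S) F (Some r)).
  by rewrite big_setU1 //= big_imset.
pose bs := W1^-1 :: [seq (X s)^-1 | s <- enum S].
have dA (i j : option 'I_n) : i \in A -> j \in A -> i != j -> th (v i / v j) != 0.
  move=> _ _; case: i j => [r|] [s|] //= rs; rewrite invrK mulrC.
  - by apply: dY; apply: contra_neq rs => ->.
  - by apply: th_neq0_sym.
  - exact: dZ.
have cA : #|A| = size bs.
  by rewrite cardsU1 NA card_imset /= ?size_map -?cardE // => r s [].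
have bs0 : all (fun b => b != 0) bs.
  by rewrite /= invr_eq0 w1 all_map; apply/allP => s _ /=; rewrite invr_eq0.
have z0 : Z1^-1 != 0 by rewrite invr_eq0.
have := lagrange thP v0 dA cA bs0 z0.
have bsP (F : K -> K) : \prod_(b <- bs) F b = F W1^-1 * \prod_(s in S) F (X s)^-1.
  by rewrite big_cons big_map big_enum.
have PX0 T : \prod_(s in T) X s != 0 by apply/prodf_neq0.
have PY0 T : \prod_(s in T) Y s != 0 by apply/prodf_neq0.
have balS : Z1 * Z2 * \prod_(r in S) Y r = W1 * W2 * \prod_(r in S) X r.
  have split (F : 'I_n -> K) : \prod_r F r = \prod_(r in S) F r * \prod_(r | r \notin S) F r.
    by rewrite (bigID (mem S)).
  have p0 : \prod_(r | r \notin S) Y r != 0 by apply/prodf_neq0.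
  apply: (mulIf p0); rewrite -!mulrA -split !mulrA bal split !mulrA; congr (_ * _).
  by apply: eq_bigr => r /XY.
have E1 : Z2^-1 * \prod_(r in S) (Y r)^-1 / (W1^-1 * \prod_(s in S) (X s)^-1) = Z1 / W2.
  have -> : Z1 = W1 * W2 * \prod_(r in S) X r / (Z2 * \prod_(r in S) Y r).
    by rewrite -balS; field; rewrite z2 PY0.
  by rewrite !prodfV; field; rewrite z2 w1 w2 PX0 PY0 oner_neq0.
have E2 y : y != 0 -> Z1^-1 * (Z2^-1 * \prod_(r in S) (Y r)^-1) /
    (W1^-1 * \prod_(s in S) (X s)^-1 / y) = y / W2.
  move=> y0; transitivity (Z1^-1 * (Z1 / W2) * y); last by field; rewrite z1 w2.
  by rewrite -E1 !prodfV; field; rewrite y0 z1 z2 w1 PX0 PY0 oner_neq0.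
have fl (w y : K) : th (w^-1 / y^-1) = th (y / w) by rewrite invrK mulrC.
have cN : cardinal th v A Z1^-1 None = \prod_(j in S) (th (Y j / Z1) / th (Y j / Z2)).
  rewrite /cardinal (_ : A :\ None = [set Some r | r in S]) ?big_imset //=.
    by apply: eq_bigr => j _; rewrite !fl.
  by rewrite setU1K.
have cS r : r \in S -> cardinal th v A Z1^-1 (Some r) =
    th (Z2 / Z1) / th (Z2 / Y r) * \prod_(j in S :\ r) (th (Y j / Z1) / th (Y j / Y r)).
  move=> rS; rewrite /cardinal.
  have -> : A :\ Some r = None |: [set Some j | j in S :\ r].
    have inj : injective (@Some 'I_n) by move=> ? ? [].
    by apply/setP => -[j|]; rewrite !inE ?(mem_imset _ _ inj) ?inE.
  rewrite big_setU1 /=; last by apply/imsetP => -[].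
  rewrite big_imset //= ?fl; last by move=> i j _ _ [].
  by congr (_ * _); apply: eq_bigr => j _; rewrite !fl.
rewrite /lagrange_formula /thprod !bsP /nodeprod !bigA /= E1 (E2 _ z2) cN.
under [X in _ = _ + X -> _]eq_bigr => r rS do rewrite (E2 _ (Y0 r)) (cS r rS) bsP fl.
have flX (w : K) : \prod_(s in S) th (w^-1 / (X s)^-1) = \prod_(s in S) th (X s / w).
  by apply: eq_bigr => s _; rewrite fl.
rewrite bsP !fl !flX.
under [X in _ = _ + X -> _]eq_bigr => r rS do rewrite flX.
move=> H.
have splitS (F : 'I_n -> K) : \prod_r F r = \prod_(r in S) F r * \prod_(r | r \notin S) F r.
  by rewrite (bigID (mem S)).
have DS0 : \prod_(j in S) th (Y j / Z2) != 0 by apply/prodf_neq0.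
rewrite splitS [X in _ = _ * _ * X * _ + _]splitS.
have -> : \prod_(r | r \notin S) th (X r / Z2) = \prod_(r | r \notin S) th (Y r / Z2).
  by apply: eq_bigr => r /XY ->.
rewrite -(mulrA (th (Z1 / W2))) H mulrDl prodf_div; congr (_ + _); first by field.
rewrite mulr_suml; apply: eq_bigr => r rS.
have EN0 : \prod_(s | s \notin S) th (Y s / Y r) != 0.
  by apply/prodf_neq0 => s sS; apply: dY; apply: contraNneq sS => ->.
have -> : \prod_s th (X s / Y r) =
    \prod_(s in S) th (X s / Y r) * \prod_(s | s \notin S) th (Y s / Y r).
  by rewrite splitS; congr (_ * _); apply: eq_bigr => s /XY ->.
have ES0 : \prod_(s in S :\ r) th (Y s / Y r) != 0.
  by apply/prodf_neq0 => s; rewrite !inE => /andP[sr _]; apply: dY.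
rewrite /node_weight [\prod_(j | j != r) _](bigID (mem S)) /=.
have -> : \prod_(s | (s != r) && (s \in S)) th (Y s / Y r) = \prod_(s in S :\ r) th (Y s / Y r).
  by apply: eq_bigl => s; rewrite !inE.
have -> : \prod_(s | (s != r) && (s \notin S)) th (Y s / Y r) =
    \prod_(s | s \notin S) th (Y s / Y r).
  by apply: eq_bigl => s; case: eqVneq => //= ->; rewrite rS.
rewrite splitS prodf_div.
by field; rewrite EN0 ES0 th_neq0_sym.
Qed.
End NodeExpansion.

(** * Shifted factorials of a theta function *)

Section Factorials.
Variables (K : fieldType) (th : K -> K) (q : K).

Definition tpoch (z : K) (k : nat) : K := \prod_(i < k) th (z * q ^+ i).
(** With d proportional to 1 / b, the factors th (d q^i)^-1, and not the
    th (d q^i), are of the form th (y * b).  The two factorials are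
    proportional, see tpoch_rpoch. *)
Definition rpoch (z : K) (k : nat) : K := \prod_(i < k) th (z * q ^+ i)^-1.

Lemma tpoch0 z : tpoch z 0 = 1. Proof. exact: big_ord0. Qed.

Lemma tpochS z k : tpoch z k.+1 = tpoch z k * th (z * q ^+ k).
Proof. exact: big_ord_recr. Qed.

Lemma tpochSl z k : tpoch z k.+1 = th z * tpoch (z * q) k.
Proof.
rewrite /tpoch big_ord_recl expr0 mulr1; congr (_ * _).
by apply: eq_bigr => i _; rewrite lift0 exprS mulrA.
Qed.

Lemma tpochD z k l : tpoch z (k + l) = tpoch z k * tpoch (z * q ^+ k) l.
Proof.
rewrite /tpoch big_split_ord; congr (_ * _).
by apply: eq_bigr => i _; rewrite exprD mulrA.
Qed.

Lemma tpoch_shift z k : th z * tpoch (z * q) k = tpoch z k * th (z * q ^+ k).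
Proof. by rewrite -tpochSl tpochS. Qed.

Lemma rpoch_shift z k : th z^-1 * rpoch (z * q) k = rpoch z k * th (z * q ^+ k)^-1.
Proof.
transitivity (rpoch z k.+1); last exact: big_ord_recr.
rewrite /rpoch big_ord_recl expr0 mulr1; congr (_ * _).
by apply: eq_bigr => i _; rewrite lift0 exprS mulrA.
Qed.
End Factorials.

Section DropFirst.
Variables (K : fieldType) (th : K -> K) (q : K) (n : nat).
Variables (z : 'I_n -> K) (l : 'I_n -> nat).
Local Notation S := [set r | (0 < l r)%N].
Local Notation P := (tpoch th q).
Local Notation rest := (\prod_r P (z r * q) (l r).-1).

(** The next three formulas isolate, in a product of factorials of lengths l r, the
    first factors, the last factors, and the last factors except one, over the
    same remaining product. *)
Lemma prod_tpoch_first : \prod_r P (z r) (l r) = (\prod_(r in S) th (z r)) * rest.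
Proof.
rewrite [\prod_(r in _) _]big_mkcond -big_split; apply: eq_bigr => r _; rewrite inE /=.
by case: (l r) => [|m] /=; [rewrite mul1r !tpoch0 | rewrite tpochSl].
Qed.

Lemma prod_tpoch_last :
  \prod_r P (z r * q) (l r) = (\prod_(r in S) th (z r * q ^+ l r)) * rest.
Proof.
rewrite [\prod_(r in _) _]big_mkcond -big_split; apply: eq_bigr => r _; rewrite inE /=.
by case: (l r) => [|m] /=; [rewrite mul1r !tpoch0 | rewrite tpochS mulrC exprS mulrA].
Qed.

Lemma prod_tpoch_dec r : (0 < l r)%N ->
  \prod_s P (z s * q) (l s - (s == r)) =
  (\prod_(s in S :\ r) th (z s * q ^+ l s)) * rest.
Proof.
move=> lr; rewrite [\prod_(s in _) _]big_mkcond -big_split; apply: eq_bigr => s _; rewrite !inE /=.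
case: eqVneq => [->|sr] /=; first by rewrite mul1r subn1.
by rewrite subn0; case: (l s) => [|m] /=; [rewrite mul1r !tpoch0 | rewrite tpochS mulrC exprS mulrA].
Qed.
End DropFirst.

Section Reflection.
Variables (K : fieldType) (th : K -> K).
Hypothesis thP : theta_like th.
Variable q : K.
Hypothesis q0 : q != 0.
Local Notation P := (tpoch th q).
Local Notation Pr := (rpoch th q).

Lemma tpoch_rpoch z m : z != 0 -> P z m = (- z) ^+ m * q ^+ 'C(m, 2) * Pr z m.
Proof.
move=> z0; elim: m => [|m IH]; first by rewrite !tpoch0 /rpoch big_ord0 !mulr1.
have zq : z * q ^+ m != 0 by rewrite mulf_neq0 ?expf_neq0.
rewrite tpochS IH /rpoch big_ord_recr /= (th_inv thP zq) binS bin1 exprD exprS.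
by field; rewrite expf_neq0 // z0.
Qed.

(** The factors of the reflected factorial in the opposite order. *)
Lemma tpoch_rev z m : z != 0 -> P (q / (z * q ^+ m)) m = Pr z m.
Proof.
move=> z0; rewrite /tpoch (reindex_inj rev_ord_inj) /=; apply: eq_bigr => i _.
congr th; have qm j : q ^+ j != 0 by rewrite expf_neq0.
have -> : q ^+ m = q ^+ (m - i.+1) * q * q ^+ i by rewrite -exprSr -exprD addSnnS subnK.
by field; rewrite z0 !qm q0.
Qed.
End Reflection.

Section Monomials.
Variables (K : fieldType) (th : K -> K).
Hypothesis thP : theta_like th.
Variable q : K.
Hypothesis q0 : q != 0.
Local Notation P := (tpoch th q).
Local Notation Pr := (rpoch th q).

Lemma theta_monomial_tpoch y m : y != 0 ->
  theta_monomial th m (y ^+ m * q ^+ 'C(m, 2)) (fun z => P (y * z) m).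
Proof.
move=> y0; elim: m => [|m IH].
  by apply: theta_monomial_ext (theta_monomial_cst th 1); rewrite ?mulr1 // => z _; rewrite tpoch0.
have yq : y * q ^+ m != 0 by rewrite mulf_neq0 ?expf_neq0.
apply: theta_monomial_ext (theta_monomial_mul IH (theta_monomial_th th yq)).
- by move=> z _; rewrite tpochS mulrAC.
- by rewrite addn1.
- by rewrite binS bin1 exprD exprSr; ring.
Qed.

(** The factor z^m compensates for the argument y / z, by the inversion formula. *)
Lemma theta_monomial_tpochV y m : y != 0 ->
  theta_monomial th m (y ^+ m * q ^+ 'C(m, 2))^-1 (fun z => z ^+ m * P (y / z) m).
Proof.
move=> y0; elim: m => [|m IH].
  apply: theta_monomial_ext (theta_monomial_cst th 1); rewrite ?mulr1 ?invr1 //.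
  by move=> z _; rewrite tpoch0 mulr1.
have yq : y * q ^+ m != 0 by rewrite mulf_neq0 ?expf_neq0.
apply: theta_monomial_ext (theta_monomial_mul IH (theta_monomial_thV thP yq)).
- by move=> z _; rewrite tpochS exprSr [y / z * _]mulrAC; ring.
- by rewrite addn1.
- by rewrite binS bin1 exprD exprSr !invfM; ring.
Qed.
End Monomials.

(** * The multiple sum and its recurrence *)

Lemma bin2_double m : ('C(m, 2) * 2 + m = m * m)%N.
Proof. by elim: m => // m IH; rewrite binS bin1; lia. Qed.

Lemma bin2_add k l : ('C(k + l, 2) = 'C(k, 2) + 'C(l, 2) + k * l)%N.
Proof.
by have := bin2_double k; have := bin2_double l; have := bin2_double (k + l); nia.
Qed.

(** The exponent of q in alpha. *)
Definition cross n (k : 'I_n -> nat) : nat := (\sum_(r < n) \sum_(s < n | (r < s)%N) k r * k s)%N.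

Lemma bin2_tsum n (k : 'I_n -> nat) :
  'C(tsum k, 2) = (\sum_r 'C(k r, 2) + cross k)%N.
Proof.
have sq : (tsum k * tsum k = \sum_r k r * k r + (cross k + cross k))%N.
  rewrite /tsum big_distrl /= -{2}/(cross k).
  have -> : (\sum_r k r * \sum_s k s = \sum_r (k r * k r +
     (\sum_(s < n | (r < s)%N) k r * k s + \sum_(s < n | (s < r)%N) k r * k s)))%N.
    apply: eq_bigr => r _; rewrite big_distrr (bigD1 r) //=; congr (_ + _)%N.
    rewrite (bigID (fun s : 'I_n => (r < s)%N)) /=; congr (_ + _)%N; apply: eq_bigl => s.
      by rewrite andbC; case: ltngtP => //= rs; apply/eqP => sr; rewrite sr ltnn in rs.
    by rewrite -leqNgt [RHS]ltn_neqAle.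
  rewrite !big_split /=; congr (_ + (_ + _))%N.
  rewrite (exchange_big_dep xpredT) //=; apply: eq_bigr => r _.
  by apply: eq_bigr => s _; rewrite mulnC.
have dbl : ((\sum_r 'C(k r, 2)) * 2 + tsum k = \sum_r k r * k r)%N.
  rewrite /tsum big_distrl -big_split /=; apply: eq_bigr => r _.
  exact: bin2_double.
by have := bin2_double (tsum k); rewrite sq -dbl; lia.
Qed.

Section Jackson.
Variables (K : fieldType) (th : K -> K).
Hypothesis thP : theta_like th.
Variables (n : nat) (q a f : K) (x : 'I_n -> K).
Hypotheses (q0 : q != 0) (a0 : a != 0) (f0 : f != 0) (x0 : forall r, x r != 0).
Hypothesis th_aq : forall m, th (a * q ^+ m) != 0.
Hypothesis th_q : forall m, th (q ^+ m.+1) != 0.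
Hypothesis th_xx : forall r s i j, r != s -> th (x r * q ^+ i / (x s * q ^+ j)) != 0.
Implicit Types (N k : 'I_n -> nat) (b c d e : K).
Local Notation P := (tpoch th q).
Local Notation Pr := (rpoch th q).

Definition dec N (r : 'I_n) : 'I_n -> nat := fun s => (N s - (s == r))%N.

Lemma tsum_dec N r : (0 < N r)%N -> (tsum (dec N r)).+1 = tsum N.
Proof.
move=> Nr; rewrite /tsum (bigD1 r) //= [in RHS](bigD1 r) //= /dec eqxx subn1.
rewrite -addSn prednK //; congr (_ + _)%N.
by apply: eq_bigr => s /negbTE ->; rewrite subn0.
Qed.

Lemma prod_shifted k : \prod_r (x r * q ^+ k r) = (\prod_r x r) * q ^+ tsum k.
Proof. by rewrite big_split /= prodrXr. Qed.

Definition denom N k : K :=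
  P (a * q) (tsum N + tsum k) *
  \prod_r \prod_s P (q * (x r * q ^+ k r) / (x s * q ^+ k s)) (N r - k r).

(** The k-th term of the sum without the factors independent of b, which are
    collected in coef, and without the factors common to all terms.  It is used for
    b c d = a f only; keeping d as an argument makes the shift from (b, d q) to
    (b q, d) in the recurrence visible. *)
Definition summand N k b c d : K :=
  (denom N k)^-1 *
  ((\prod_r P (b * x r * q ^+ tsum N) (k r)) *
   \prod_r P (b * (x r * q ^+ k r) / (a * q ^+ tsum k)) (N r - k r)) *
  (rpoch th q d (tsum k) * P (a * q ^+ (tsum k).+1 / d) (tsum N - tsum k)) *
  (P c (tsum k) * P (a * q ^+ (tsum k).+1 / c) (tsum N - tsum k)).

Definition closed N b c : K :=
  P (b * q / f) (tsum N) *
  (\prod_r P (b * c * x r / a) (N r)) *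
  (\prod_r (P (f * x r / c) (N r) / P (f * x r) (N r))) /
  \prod_r \prod_s P (q * x r / x s) (N r).

(** The weight of the node x r q^(N r), times the ratio between the remaining
    factors of the expansion and the normalization of the summand of dec N r. *)
Definition rec_weight N b c d (r : 'I_n) : K :=
  node_weight th (fun s => x s * q ^+ N s) (b * q ^+ tsum N)^-1 (d / b) r *
  ((-1) ^+ n.+1 * (\prod_s x s) / (q ^+ tsum N * a * (x r * q ^+ N r) ^+ n)) *
  th (c * q / (f * (x r * q ^+ N r))) * th (a * q ^+ tsum N / c).

Lemma denom_dec N k r : (k r < N r)%N ->
  denom N k = denom (dec N r) k *
    (th (a * q ^+ (tsum N + tsum k)) * \prod_s th (x r * q ^+ N r / (x s * q ^+ k s))).
Proof.
move=> kN; have Nr : (0 < N r)%N by apply: leq_trans kN.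
have H1 : P (a * q) (tsum N + tsum k) =
    P (a * q) (tsum (dec N r) + tsum k) * th (a * q ^+ (tsum N + tsum k)).
  by rewrite -(tsum_dec Nr) addSn tpochS exprS mulrA.
have H2 : \prod_r \prod_s P (q * (x r * q ^+ k r) / (x s * q ^+ k s)) (N r - k r) =
    \prod_r0 \prod_s P (q * (x r0 * q ^+ k r0) / (x s * q ^+ k s)) (dec N r r0 - k r0) *
    \prod_s th (x r * q ^+ N r / (x s * q ^+ k s)).
  rewrite (bigD1 r) //= [in RHS](bigD1 r) //= mulrAC -big_split /=; congr (_ * _).
    apply: eq_bigr => s _; rewrite /dec eqxx.
    rewrite (_ : (N r - k r = (N r - 1 - k r).+1)%N) ?tpochS; last first.
      by rewrite subnAC subn1 prednK // subn_gt0.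
    have -> : q ^+ N r = q * q ^+ k r * q ^+ (N r - 1 - k r).
      by rewrite -exprS -subnDA add1n -exprD subnKC.
    by congr (_ * th _); ring.
  apply: eq_bigr => s /negbTE sr; apply: eq_bigr => t _.
  by rewrite /dec sr subn0.
by rewrite /denom H1 H2; ring.
Qed.

Lemma denom_ratio_neq0 N k r : (forall s, k s <= N s)%N -> (k r < N r)%N ->
  th (a * q ^+ (tsum N + tsum k)) * \prod_s th (x r * q ^+ N r / (x s * q ^+ k s)) != 0.
Proof.
move=> kN krN; rewrite mulf_neq0 //; apply/prodf_neq0 => s _.
have [<-|rs] := eqVneq r s; last exact: th_xx.
have -> : x r * q ^+ N r / (x r * q ^+ k r) = q ^+ (N r - k r - 1).+1.
  have -> : q ^+ N r = q ^+ (N r - k r - 1).+1 * q ^+ k r by rewrite -exprD subn1 prednK ?subn_gt0 // subnK // ltnW.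
  by field; rewrite x0 expf_neq0.
exact: th_q.
Qed.

Lemma tsum_le N k : (forall r, k r <= N r)%N -> (tsum k <= tsum N)%N.
Proof. by move=> kN; apply: leq_sum => r _. Qed.

Lemma tsum_lt N k r : (forall r, k r <= N r)%N -> (k r < N r)%N -> (tsum k < tsum N)%N.
Proof.
move=> kN kr; rewrite /tsum (bigD1 r) //= [ltnRHS](bigD1 r) //= -addSn.
by apply: leq_add => //; apply: leq_sum.
Qed.

(** For k = N there is no smaller tuple above k: the expansion is reduced to its
    first term and the recurrence to a shift of factorials. *)
Lemma summand_rec_top N b c d : b != 0 -> d != 0 ->
  (\prod_r th (b * (x r * q ^+ N r) * q ^+ tsum N)) * th d^-1 * summand N N b c (d * q) =
  (\prod_r th (b * x r * q ^+ tsum N)) * th (d * q ^+ tsum N)^-1 * summand N N (b * q) c d.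
Proof.
move=> b0 d0; rewrite /summand !subnn !tpoch0 !mulr1.
have one (F : 'I_n -> K) : \prod_r P (F r) (N r - N r) = 1.
  by apply: big1 => r _; rewrite subnn tpoch0.
rewrite !one !mulr1.
have H : (\prod_r th (b * (x r * q ^+ N r) * q ^+ tsum N)) * \prod_r P (b * x r * q ^+ tsum N) (N r) =
   (\prod_r th (b * x r * q ^+ tsum N)) * \prod_r P (b * q * x r * q ^+ tsum N) (N r).
  rewrite -!big_split; apply: eq_bigr => r _ /=.
  rewrite (_ : b * q * x r * q ^+ tsum N = b * x r * q ^+ tsum N * q); last by ring.
  by rewrite tpoch_shift mulrC; congr (_ * th _); ring.
have R := rpoch_shift th q d (tsum N).
transitivity ((denom N N)^-1 * P c (tsum N) *
  ((\prod_r th (b * (x r * q ^+ N r) * q ^+ tsum N)) * \prod_r P (b * x r * q ^+ tsum N) (N r)) *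
  (th d^-1 * rpoch th q (d * q) (tsum N))); first by ring.
by rewrite H R; ring.
Qed.

Lemma expq0 m : q ^+ m != 0. Proof. exact: expf_neq0. Qed.

Lemma flip_prod (X : 'I_n -> K) (y : K) : (forall r, X r != 0) -> y != 0 ->
  \prod_s th (X s / y) = (-1) ^+ n * (\prod_s X s) / y ^+ n * \prod_s th (y / X s).
Proof.
move=> X0 y0.
have -> : (-1) ^+ n * (\prod_s X s) / y ^+ n = \prod_s (- (X s / y)).
  have e (w : K) : w ^+ n = \prod_(s < n) w by rewrite prodr_const card_ord.
  rewrite -exprVn !e -!big_split; apply: eq_bigr => s _ /=.
  by rewrite mulN1r mulNr.
by rewrite -big_split; apply: eq_bigr => s _ /=; rewrite (th_flip thP) // mulNr.
Qed.

(** The expansion with X s = x s q^(k s), Y s = x s q^(N s), Z1 = a q^|k| / b,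
    Z2 = 1 / (b q^|N|), W1 = a / (b d) and W2 = d / b, multiplied by the common
    factor H of the three kinds of summands. *)
Lemma summand_rec N k b c d r0 :
  (forall r, k r <= N r)%N -> (k r0 < N r0)%N ->
  b != 0 -> c != 0 -> d != 0 -> b * c * (d * q) = a * f ->
  (forall r, th (b * (x r * q ^+ N r) * q ^+ tsum N) != 0) ->
  (\prod_r th (b * (x r * q ^+ N r) * q ^+ tsum N)) * th d^-1 * summand N k b c (d * q) =
  (\prod_r th (b * x r * q ^+ tsum N)) * th (d * q ^+ tsum N)^-1 * summand N k (b * q) c d +
  \sum_(r | (k r < N r)%N) rec_weight N b c d r * summand (dec N r) k (b * q) c d.
Proof.
move=> kN kr0 b0 c0 d0 bcd D0.
have KM := tsum_lt kN kr0.
pose X s := x s * q ^+ k s; pose Y s := x s * q ^+ N s.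
pose M := tsum N; pose L := tsum k.
pose Z1 := a * q ^+ L / b; pose Z2 := (b * q ^+ M)^-1.
pose W1 := a / (b * d); pose W2 := d / b.
pose l r := (N r - k r)%N; pose z r := X r / Z1.
pose S : {set 'I_n} := [set r | (0 < l r)%N].
have X0 r : X r != 0 by rewrite mulf_neq0 ?expq0.
have Y0 r : Y r != 0 by rewrite mulf_neq0 ?expq0.
have z1 : Z1 != 0 by rewrite !mulf_neq0 ?invr_neq0 ?expq0.
have z2 : Z2 != 0 by rewrite invr_neq0 // mulf_neq0 ?expq0.
have w1 : W1 != 0 by rewrite mulf_neq0 ?invr_neq0 ?mulf_neq0.
have w2 : W2 != 0 by rewrite mulf_neq0 ?invr_neq0.
have XY r : r \notin S -> X r = Y r.
  rewrite inE -eqn0Ngt subn_eq0 => Nk; rewrite /X /Y (_ : k r = N r) //.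
  by apply/eqP; rewrite eqn_leq kN.
have qL := expq0 L; have qM := expq0 M.
have bal : Z1 * Z2 * \prod_r Y r = W1 * W2 * \prod_r X r.
  rewrite !prod_shifted -/L -/M /Z1 /Z2 /W1 /W2; move: (\prod_r x r) => px.
  by field; rewrite qM b0 d0.
have YZ2 r : Y r / Z2 = b * Y r * q ^+ M by rewrite /Z2 invrK; ring.
have dY r s : r != s -> th (Y r / Y s) != 0 by exact: th_xx.
have dZ r : th (Y r / Z2) != 0 by rewrite YZ2; apply: D0.
have := node_expansion thP X0 Y0 z1 z2 w1 w2 XY bal dY dZ.
have -> : \prod_j th (Y j / Z2) = \prod_r th (b * Y r * q ^+ M).
  by apply: eq_bigr => r _; rewrite YZ2.
set D := \prod_r th (b * Y r * q ^+ M).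
have eM : (M - L = (M - L).-1.+1)%N by rewrite prednK // subn_gt0.
pose rest := \prod_r P (z r * q) (l r).-1.
pose A := \prod_r P (b * x r * q ^+ M) (k r).
pose Pd := P (a * q ^+ L.+1 / d) (M - L).-1.
pose Pc := P (a * q ^+ L.+1 / c) (M - L).-1.
pose H := (denom N k)^-1 * A * rest * rpoch th q d L * Pd * P c L * Pc * th (a * q ^+ M / c).
move=> E.
have zE r : b * (x r * q ^+ k r) / (a * q ^+ L) = z r.
  by rewrite /z /Z1 -/(X r); field; rewrite a0 b0 qL.
have zlE r : z r * q ^+ l r = Y r / Z1.
  have qN : q ^+ N r = q ^+ k r * q ^+ l r by rewrite -exprD subnKC.
  by rewrite /z /X /Y qN; ring.
have lastE e : P (a * q ^+ L.+1 / e) (M - L) = P (a * q ^+ L.+1 / e) (M - L).-1 * th (a * q ^+ M / e).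
  rewrite {1}eM tpochS; congr (_ * th _).
  have -> : q ^+ M = q ^+ L.+1 * q ^+ (M - L).-1 by rewrite -exprD addSnnS -eM subnKC // ltnW.
  by ring.
have E1 : D * th d^-1 * summand N k b c (d * q) =
    H * (th (Z1 / W2) * th (W1 / Z1) * (\prod_(s in S) th (X s / Z1)) * D).
  rewrite /summand -/M -/L -/A (lastE c).
  have -> : \prod_r P (b * (x r * q ^+ k r) / (a * q ^+ L)) (N r - k r) =
      (\prod_(s in S) th (X s / Z1)) * rest.
    by rewrite -prod_tpoch_first; apply: eq_bigr => r _; rewrite zE.
  have -> : P (a * q ^+ L.+1 / (d * q)) (M - L) = th (Z1 / W2) * Pd.
    by rewrite eM tpochSl; congr (th _ * P _ _); rewrite /Z1 /W2 exprS; field; rewrite ?b0 d0 q0.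
  have -> : th (W1 / Z1) = th (d * q ^+ L)^-1.
    by congr (th _); rewrite /W1 /Z1; field; rewrite a0 b0 d0 qL.
  have R := rpoch_shift th q d L.
  transitivity (D * (th d^-1 * rpoch th q (d * q) L) * ((denom N k)^-1 *
     (A * (\prod_(s in S) th (X s / Z1) * rest)) * (th (Z1 / W2) * Pd) * (P c L * (Pc * th (a * q ^+ M / c))))).
    by rewrite /Pc; ring.
  by rewrite R /H; ring.
have E2 : (\prod_r th (b * x r * q ^+ M)) * th (d * q ^+ M)^-1 * summand N k (b * q) c d =
    H * (th (Z2 / W2) * th (W1 / Z2) * (\prod_s th (X s / Z2)) * \prod_(j in S) th (Y j / Z1)).
  rewrite /summand -/M -/L !lastE.
  have HA : (\prod_r th (b * x r * q ^+ M)) * \prod_r P (b * q * x r * q ^+ M) (k r) =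
      A * \prod_s th (X s / Z2).
    rewrite /A -!big_split; apply: eq_bigr => r _ /=.
    rewrite (_ : b * q * x r * q ^+ M = b * x r * q ^+ M * q); last by ring.
    by rewrite tpoch_shift; congr (_ * th _); rewrite /X /Z2 invrK; ring.
  have -> : \prod_r P (b * q * (x r * q ^+ k r) / (a * q ^+ L)) (N r - k r) =
      (\prod_(s in S) th (Y s / Z1)) * rest.
    rewrite (_ : \prod_(s in S) th (Y s / Z1) = \prod_(s in S) th (z s * q ^+ l s)).
      rewrite -prod_tpoch_last; apply: eq_bigr => r _; congr (P _ _).
      by rewrite -(zE r); ring.
    by apply: eq_bigr => s _; rewrite zlE.
  have -> : th (Z2 / W2) = th (d * q ^+ M)^-1.
    by congr (th _); rewrite /Z2 /W2; field; rewrite b0 d0 qM.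
  have -> : th (W1 / Z2) = th (a * q ^+ M / d).
    by congr (th _); rewrite /Z2 /W1 invrK; field; rewrite b0 d0.
  transitivity (th (d * q ^+ M)^-1 * ((denom N k)^-1 *
    ((\prod_r th (b * x r * q ^+ M) * \prod_r P (b * q * x r * q ^+ M) (k r)) *
      ((\prod_(s in S) th (Y s / Z1)) * rest)) *
    (rpoch th q d L * (Pd * th (a * q ^+ M / d))) * (P c L * (Pc * th (a * q ^+ M / c))))).
    by rewrite /Pd /Pc; ring.
  by rewrite HA /H; ring.
have E3 r : r \in S -> rec_weight N b c d r * summand (dec N r) k (b * q) c d =
    H * (node_weight th Y Z2 W2 r * th (Z2 / Z1) * th (W1 / Y r) *
     (\prod_s th (X s / Y r)) * (\prod_(j in S :\ r) th (Y j / Z1))).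
  rewrite inE subn_gt0 => kr; have Nr : (0 < N r)%N by apply: leq_trans kr.
  have MS := tsum_dec Nr; rewrite -/M in MS.
  have ML : (tsum (dec N r) - L = (M - L).-1)%N by rewrite -MS subSn //; move: KM; rewrite -/M -MS.
  have den : denom N k = denom (dec N r) k *
      (th (a * q ^+ (tsum N + tsum k)) * \prod_s th (x r * q ^+ N r / (x s * q ^+ k s))).
    exact: denom_dec.
  have den0 : th (a * q ^+ (tsum N + tsum k)) *
      \prod_s th (x r * q ^+ N r / (x s * q ^+ k s)) != 0 by apply: denom_ratio_neq0.
  have denV : (denom (dec N r) k)^-1 = (denom N k)^-1 *
     (th (a * q ^+ (M + L)) * \prod_s th (Y r / X s)).
    by rewrite den [in RHS]invfM -mulrA (mulVf den0) mulr1.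
  rewrite /summand denV ML -/L -/Pd -/Pc.
  have -> : \prod_s P (b * q * x s * q ^+ tsum (dec N r)) (k s) = A.
    by apply: eq_bigr => s _; rewrite -MS exprS; congr (P _ _); ring.
  have -> : \prod_s P (b * q * (x s * q ^+ k s) / (a * q ^+ L)) (dec N r s - k s) =
      (\prod_(s in S :\ r) th (Y s / Z1)) * rest.
    rewrite (_ : \prod_(s in S :\ r) th (Y s / Z1) = \prod_(s in S :\ r) th (z s * q ^+ l s)).
      rewrite -prod_tpoch_dec ?subn_gt0 //; apply: eq_bigr => s _; rewrite /dec subnAC.
      by congr (P _ _); rewrite -(zE s); ring.
    by apply: eq_bigr => s _; rewrite zlE.
  have hW : W1 = c * q / f.
    have -> : W1 = a * f / (b * d * f) by rewrite /W1; field; rewrite b0 d0 f0.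
    by rewrite -bcd; field; rewrite b0 d0 f0.
  have hZ : th (Z2 / Z1) = - (1 / (a * q ^+ (M + L)) * th (a * q ^+ (M + L))).
    have -> : Z2 / Z1 = 1 / (a * q ^+ (M + L)).
      by rewrite /Z2 /Z1 exprD; field; rewrite a0 b0 qM qL.
    by rewrite (th_flip thP) ?oner_neq0 ?mulf_neq0 ?expq0 // divr1.
  have hX := flip_prod X0 (Y0 r).
  have hWY : W1 / Y r = c * q / (f * Y r) by rewrite hW; field; rewrite f0 Y0.
  have yn : Y r ^+ n != 0 by rewrite expf_neq0.
  have pX : \prod_s X s = (\prod_s x s) * q ^+ L by rewrite prod_shifted.
  rewrite hZ hX hWY pX /rec_weight -/M -/(Y r) /H exprD exprS.
  move: (node_weight _ _ _ _ _) (denom _ _)^-1 yn => w V yn.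
  by field; rewrite a0 qM qL yn.
rewrite E1 E E2 mulrDr mulr_sumr; congr (_ + _); apply: eq_big => r.
  by rewrite inE subn_gt0.
by move=> rS; rewrite E3.
Qed.

Hypothesis th_fx : forall r m, th (f * x r * q ^+ m) != 0.

Lemma last_arg (y : K) m : (0 < m)%N -> y * q ^+ m.-1 = y * q ^+ m / q.
Proof. by case: m => // m _; rewrite exprSr mulrA mulfK. Qed.

Lemma tpoch_pred (y : K) m : (0 < m)%N -> P y m = P y m.-1 * th (y * q ^+ m / q).
Proof. by move=> m0; rewrite -{1}(prednK m0) tpochS last_arg. Qed.

Lemma closed_ratio_dec N r c : c != 0 -> (0 < N r)%N ->
  (\prod_s (P (f * x s / c) (dec N r s) / P (f * x s) (dec N r s))) *
    th (f * (x r * q ^+ N r) / (c * q)) =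
  (\prod_s (P (f * x s / c) (N s) / P (f * x s) (N s))) * th (f * (x r * q ^+ N r) / q).
Proof.
move=> c0 Nr; rewrite (bigD1 r) //= [in RHS](bigD1 r) //= /dec eqxx subn1.
rewrite [P (f * x r / c) (N r)]tpoch_pred // [P (f * x r) (N r)]tpoch_pred //.
have -> : \prod_(s | s != r) (P (f * x s / c) (N s - (s == r)) / P (f * x s) (N s - (s == r))) =
    \prod_(s | s != r) (P (f * x s / c) (N s) / P (f * x s) (N s)).
  by apply: eq_bigr => s /negbTE ->; rewrite subn0.
have -> : f * x r / c * q ^+ N r / q = f * (x r * q ^+ N r) / (c * q) by field; rewrite ?c0 ?q0.
have -> : f * x r * q ^+ N r / q = f * (x r * q ^+ N r) / q by rewrite mulrA.
have t0 : th (f * (x r * q ^+ N r) / q) != 0 by rewrite mulrA -last_arg.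
have P0 : P (f * x r) (N r).-1 != 0 by apply/prodf_neq0.
by field; rewrite t0.
Qed.

Lemma closed_denom_dec N r : (0 < N r)%N ->
  (\prod_s \prod_t P (q * x s / x t) (dec N r s))^-1 =
  (\prod_s \prod_t P (q * x s / x t) (N s))^-1 * \prod_s th (x r * q ^+ N r / x s).
Proof.
move=> Nr.
have n0 : \prod_s th (x r * q ^+ N r / x s) != 0.
  apply/prodf_neq0 => s _; have [<-|rs] := eqVneq r s.
    by rewrite mulrC mulKf // -(prednK Nr).
  by have := th_xx (N r) 0 rs; rewrite mulr1.
have -> : \prod_s \prod_t P (q * x s / x t) (N s) =
    \prod_s \prod_t P (q * x s / x t) (dec N r s) * \prod_s th (x r * q ^+ N r / x s).
  rewrite (bigD1 r) //= [in RHS](bigD1 r) //= mulrAC -big_split /=; congr (_ * _).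
    apply: eq_bigr => s _; rewrite tpoch_pred // /dec eqxx subn1; congr (_ * th _).
    by field; rewrite q0 x0.
  by apply: eq_bigr => s /negbTE sr; apply: eq_bigr => t _; rewrite /dec sr subn0.
by rewrite [in RHS]invfM divfK.
Qed.

(** The expansion with the same Y, Z2 and W2 as in summand_rec, hence with the same
    weights, but with X = x, Z1 = a / (b c) and W1 = q / f. *)
Lemma closed_rec N b c d r0 : (0 < N r0)%N ->
  b != 0 -> c != 0 -> d != 0 -> b * c * (d * q) = a * f ->
  (forall r, th (b * (x r * q ^+ N r) * q ^+ tsum N) != 0) ->
  (\prod_r th (b * (x r * q ^+ N r) * q ^+ tsum N)) * th d^-1 * closed N b c =
  (\prod_r th (b * x r * q ^+ tsum N)) * th (d * q ^+ tsum N)^-1 * closed N (b * q) c +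
  \sum_(r | (0 < N r)%N) rec_weight N b c d r * closed (dec N r) (b * q) c.
Proof.
move=> Nr0 b0 c0 d0 bcd D0.
pose Y s := x s * q ^+ N s; pose M := tsum N.
have M0 : (0 < M)%N by rewrite /M -(tsum_dec Nr0).
pose Z1 := a / (b * c); pose Z2 := (b * q ^+ M)^-1.
pose W1 := q / f; pose W2 := d / b; pose z r := x r / Z1.
pose S : {set 'I_n} := [set r | (0 < N r)%N].
have Y0 r : Y r != 0 by rewrite mulf_neq0 ?expq0.
have z1 : Z1 != 0 by rewrite !mulf_neq0 ?invr_neq0 ?mulf_neq0.
have z2 : Z2 != 0 by rewrite invr_neq0 // mulf_neq0 ?expq0.
have w1 : W1 != 0 by rewrite mulf_neq0 ?invr_neq0 ?mulf_neq0.
have w2 : W2 != 0 by rewrite mulf_neq0 ?invr_neq0.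
have XY r : r \notin S -> x r = Y r.
  by rewrite inE -eqn0Ngt /Y => /eqP ->; rewrite mulr1.
have qM := expq0 M.
have fE : f = b * c * d * q / a.
  have -> : b * c * d * q = a * f by rewrite -bcd; ring.
  by field.
have bal : Z1 * Z2 * \prod_r Y r = W1 * W2 * \prod_r x r.
  rewrite !prod_shifted -/M /Z1 /Z2 /W1 /W2 fE; move: (\prod_r x r) => px.
  by field; rewrite a0 b0 c0 d0 q0 qM.
have YZ2 r : Y r / Z2 = b * Y r * q ^+ M by rewrite /Z2 invrK; ring.
have dY r s : r != s -> th (Y r / Y s) != 0 by exact: th_xx.
have dZ r : th (Y r / Z2) != 0 by rewrite YZ2; apply: D0.
have := node_expansion thP x0 Y0 z1 z2 w1 w2 XY bal dY dZ.
have -> : \prod_j th (Y j / Z2) = \prod_r th (b * Y r * q ^+ M).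
  by apply: eq_bigr => r _; rewrite YZ2.
set D := \prod_r th (b * Y r * q ^+ M) => E.
pose rest := \prod_r P (z r * q) (N r).-1.
pose Pb := P (b * q / f * q) M.-1.
pose H := Pb * rest * (\prod_r (P (f * x r / c) (N r) / P (f * x r) (N r))) /
  \prod_r \prod_s P (q * x r / x s) (N r).
have zE r : b * c * x r / a = z r by rewrite /z /Z1; field; rewrite a0 b0 c0.
have zqE r : b * q * c * x r / a = z r * q by rewrite -zE; ring.
have zlE r : z r * q ^+ N r = Y r / Z1 by rewrite /z /Y mulrAC.
have E1 : D * th d^-1 * closed N b c =
    H * (th (Z1 / W2) * th (W1 / Z1) * (\prod_(s in S) th (x s / Z1)) * D).
  rewrite /closed -/M.
  have -> : \prod_r P (b * c * x r / a) (N r) = (\prod_(s in S) th (x s / Z1)) * rest.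
    by rewrite -prod_tpoch_first; apply: eq_bigr => r _; rewrite zE.
  have -> : P (b * q / f) M = th (Z1 / W2) * Pb.
    rewrite -{1}(prednK M0) tpochSl; congr (th _ * _).
    by rewrite fE /Z1 /W2; field; rewrite a0 b0 c0 d0 q0.
  have -> : th (W1 / Z1) = th d^-1.
    by congr (th _); rewrite /W1 /Z1 fE; field; rewrite a0 b0 c0 d0 q0.
  by rewrite /H; ring.
have E2 : (\prod_r th (b * x r * q ^+ M)) * th (d * q ^+ M)^-1 * closed N (b * q) c =
    H * (th (Z2 / W2) * th (W1 / Z2) * (\prod_s th (x s / Z2)) * \prod_(j in S) th (Y j / Z1)).
  rewrite /closed -/M.
  have -> : \prod_r P (b * q * c * x r / a) (N r) = (\prod_(s in S) th (Y s / Z1)) * rest.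
    rewrite (_ : \prod_(s in S) th (Y s / Z1) = \prod_(s in S) th (z s * q ^+ N s)).
      by rewrite -prod_tpoch_last; apply: eq_bigr => r _; rewrite zqE.
    by apply: eq_bigr => s _; rewrite zlE.
  have -> : \prod_s th (x s / Z2) = \prod_r th (b * x r * q ^+ M).
    by apply: eq_bigr => r _; congr (th _); rewrite /Z2 invrK; ring.
  have -> : th (Z2 / W2) = th (d * q ^+ M)^-1.
    by congr (th _); rewrite /Z2 /W2; field; rewrite b0 d0 qM.
  have -> : P (b * q * q / f) M = Pb * th (W1 / Z2).
    rewrite tpoch_pred // (_ : b * q * q / f = b * q / f * q); last by ring.
    by congr (_ * th _); rewrite /W1 /Z2 invrK; field; rewrite f0.
  by rewrite /H; ring.
have E3 r : r \in S -> rec_weight N b c d r * closed (dec N r) (b * q) c =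
    H * (node_weight th Y Z2 W2 r * th (Z2 / Z1) * th (W1 / Y r) *
     (\prod_s th (x s / Y r)) * (\prod_(j in S :\ r) th (Y j / Z1))).
  rewrite inE => Nr; have MS := tsum_dec Nr; rewrite -/M in MS.
  rewrite /closed closed_denom_dec // -/(Y r).
  have -> : \prod_s P (b * q * c * x s / a) (dec N r s) = (\prod_(s in S :\ r) th (Y s / Z1)) * rest.
    rewrite (_ : \prod_(s in S :\ r) th (Y s / Z1) = \prod_(s in S :\ r) th (z s * q ^+ N s)).
      by rewrite -prod_tpoch_dec //; apply: eq_bigr => s _; rewrite zqE.
    by apply: eq_bigr => s _; rewrite zlE.
  have -> : P (b * q * q / f) (tsum (dec N r)) = Pb.
    by rewrite /Pb -MS; congr (P _ _); ring.
  have R := closed_ratio_dec c0 Nr; rewrite -/(Y r) in R.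
  have yr := Y0 r.
  have hZ : th (Z2 / Z1) = - (c / (a * q ^+ M) * th (a * q ^+ M / c)).
    rewrite -(th_flip thP) ?mulf_neq0 ?expq0 //; congr (th _).
    by rewrite /Z2 /Z1; field; rewrite a0 b0 c0 qM.
  have hW : th (W1 / Y r) = - (q / (f * Y r) * th (f * Y r / q)).
    transitivity (th (q / (f * Y r))); last by rewrite (th_flip thP) //; apply: mulf_neq0.
    by congr (th _); rewrite /W1; field; rewrite f0 Y0.
  have hc : th (c * q / (f * Y r)) = - (c * q / (f * Y r) * th (f * Y r / (c * q))).
    by rewrite (th_flip thP) //; apply: mulf_neq0.
  have hX := flip_prod x0 (Y0 r).
  have yn : Y r ^+ n != 0 by rewrite expf_neq0.
  rewrite hZ hW hX /rec_weight -/M -/(Y r) /H exprS hc.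
  move: R; set R1 := \prod_s (_ / _); set R2 := \prod_s (_ / _).
  move: (node_weight _ _ _ _ _) (\prod_s \prod_t _)^-1 => w V R.
  transitivity (w * ((-1) ^+ n * (\prod_s x s) / (q ^+ M * a * Y r ^+ n)) * (c * q / (f * Y r)) *
     th (a * q ^+ M / c) * Pb * ((\prod_(s in S :\ r) th (Y s / Z1)) * rest) *
     (V * \prod_s th (Y r / x s)) * (R1 * th (f * Y r / (c * q)))).
    by field; rewrite f0 a0 yr yn qM.
  by rewrite R; field; rewrite f0 a0 yr yn qM.
rewrite E1 E E2 mulrDr mulr_sumr; congr (_ + _); apply: eq_big => r.
  by rewrite inE.
by move=> rS; rewrite E3.
Qed.

Hypothesis P_e : forall k r, P (a * q / (f * x r)) (tsum k - k r) != 0.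

(** The part of the k-th term of alpha that involves neither b, c nor d, f being
    fixed. *)
Definition kappa k : K :=
  th (a * q ^+ (2 * tsum k)) / th a * P a (tsum k) /
  (\prod_r \prod_s P (q * x r / x s) (k r)) *
  (\prod_r (P (a * q / (f * x r)) (tsum k) /
     (P (a * q / (f * x r)) (tsum k - k r) * P (f * x r) (k r)))) *
  a ^- tsum k * q ^- cross k * \prod_r x r ^+ k r.

(** The constant is the one that turns the factors rpoch d of the summand into the
    factors b^|k| (d)_|k| of alpha, by coef_rpoch. *)
Definition coef k c : K := kappa k * (- (a * f / c)) ^+ tsum k * q ^+ 'C(tsum k, 2).

Lemma coef_rpoch k b c : b != 0 -> c != 0 ->
  coef k c * Pr (a * f / (b * c)) (tsum k) =
  kappa k * b ^+ tsum k * P (a * f / (b * c)) (tsum k).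
Proof.
move=> b0 c0; have d0 : a * f / (b * c) != 0 by rewrite !mulf_neq0 ?invr_neq0 ?mulf_neq0.
rewrite (tpoch_rpoch thP q0 _ d0) /coef.
have -> : - (a * f / c) = b * (- (a * f / (b * c))) by field; rewrite b0 c0.
by rewrite exprMn; ring.
Qed.

Lemma le_tsum N r : (N r <= tsum N)%N.
Proof. by rewrite /tsum (bigD1 r) //= leq_addr. Qed.

(** With d = a q^|N| both sides are products of the same factorials, up to
    reversal; the powers of q agree because
    C(|N|, 2) = sum of the C(N r, 2) + cross N. *)
Lemma summand_top N b c : b != 0 -> c != 0 -> b * c * q ^+ tsum N = f ->
  coef N c * summand N N b c (a * q ^+ tsum N) = closed N b c.
Proof.
move=> b0 c0 bcf; set M := tsum N.
have qn m : q ^+ m != 0 by rewrite expf_neq0.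
have dE : a * q ^+ M = a * f / (b * c) by rewrite -bcf -/M; field; rewrite b0 c0.
pose z r := f * x r / (a * q ^+ M).
have z0 r : z r != 0 by rewrite !mulf_neq0 ?invr_neq0 ?mulf_neq0.
have triv (F : 'I_n -> K) : \prod_r P (F r) (N r - N r) = 1.
  by apply: big1 => r _; rewrite subnn tpoch0.
have denE : denom N N = P (a * q) (M + M).
  rewrite /denom -/M big1 ?mulr1 // => r _; apply: big1 => s _.
  by rewrite subnn tpoch0.
rewrite /summand -/M subnn !tpoch0 !mulr1 triv denE.
have cR := coef_rpoch N b0 c0; rewrite -dE -/M in cR.
transitivity ((coef N c * Pr (a * q ^+ M) M) * (P (a * q) (M + M))^-1 *
  (\prod_r P (b * x r * q ^+ M) (N r)) * P c M); first by ring.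
rewrite cR.
have Pa : th (a * q ^+ (2 * M)) / th a * P a M * P (a * q ^+ M) M / P (a * q) (M + M) = 1.
  have h : th a * P (a * q) (M + M) = P a M * P (a * q ^+ M) M * th (a * q ^+ (2 * M)).
    by rewrite tpoch_shift tpochD mul2n addnn.
  have n1 : P (a * q) (M + M) != 0.
    by apply/prodf_neq0 => i _; rewrite -mulrA -exprS.
  have n2 : th a != 0 by have := th_aq 0; rewrite mulr1.
  apply: (mulIf (mulf_neq0 n2 n1)); rewrite mul1r [RHS]h; field.
  by rewrite n1 n2.
have bx r : b * x r * q ^+ M = f * x r / c by rewrite -bcf -/M; field.
have bcz r : b * c * x r / a = z r by rewrite /z -bcf -/M; field; rewrite a0 qn.
have bq : P (b * q / f) M = Pr c M.
  by rewrite -(@tpoch_rev _ th _ q0 _ _ c0); congr (P _ _); rewrite -bcf -/M; field; rewrite ?b0 ?c0 ?qn.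
have eR r : P (a * q / (f * x r)) M / P (a * q / (f * x r)) (M - N r) = Pr (z r) (N r).
  have eM : (M - N r + N r)%N = M := subnK (le_tsum N r).
  rewrite -{1}eM tpochD mulrAC divff ?P_e // mul1r.
  rewrite -(@tpoch_rev _ th _ q0 _ _ (z0 r)); congr (P _ _); rewrite /z.
  have -> : q ^+ M = q ^+ (M - N r) * q ^+ N r by rewrite -exprD eM.
  by field; rewrite f0 a0 x0 !qn.
rewrite /kappa /closed -/M bq.
have -> : \prod_r P (b * x r * q ^+ M) (N r) = \prod_r P (f * x r / c) (N r).
  by apply: eq_bigr => r _; rewrite bx.
have -> : \prod_r P (b * c * x r / a) (N r) =
    (\prod_r ((- z r) ^+ N r * q ^+ 'C(N r, 2))) * \prod_r Pr (z r) (N r).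
  by rewrite -big_split; apply: eq_bigr => r _ /=; rewrite bcz (tpoch_rpoch thP q0).
have -> : \prod_r (P (a * q / (f * x r)) M / (P (a * q / (f * x r)) (M - N r) * P (f * x r) (N r))) =
    (\prod_r Pr (z r) (N r)) * \prod_r (P (f * x r) (N r))^-1.
  rewrite -[RHS]big_split; apply: eq_bigr => r _ /=.
  by rewrite -eR -[RHS]mulrA; congr (_ * _); rewrite invfM.
have -> : \prod_r (P (f * x r / c) (N r) / P (f * x r) (N r)) =
    (\prod_r P (f * x r / c) (N r)) * \prod_r (P (f * x r) (N r))^-1 by rewrite -big_split.
have -> : \prod_r ((- z r) ^+ N r * q ^+ 'C(N r, 2)) =
    (- (f / (a * q ^+ M))) ^+ M * (\prod_r x r ^+ N r) * q ^+ (\sum_r 'C(N r, 2)).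
  have -> : (- (f / (a * q ^+ M))) ^+ M = \prod_r (- (f / (a * q ^+ M))) ^+ N r by rewrite prodrXr.
  have -> : q ^+ (\sum_r 'C(N r, 2)) = \prod_r q ^+ 'C(N r, 2) by rewrite prodrXr.
  rewrite -!big_split; apply: eq_bigr => r _ /=; rewrite -exprMn; congr (_ ^+ _ * _).
  by rewrite /z; ring.
rewrite (tpoch_rpoch thP q0 M c0) bin2_tsum exprD.
have el : b ^+ M * a ^- M * (- c) ^+ M = (- (f / (a * q ^+ M))) ^+ M.
  by rewrite -exprVn -!exprMn; congr (_ ^+ _); rewrite -bcf -/M; field; rewrite a0 qn.
have qc := qn (cross N).
move: Pa el; move: (\prod_r \prod_s _)^-1 (\prod_r Pr _ _) (\prod_r (P _ _)^-1) (\prod_r P _ _) (\prod_r _ ^+ _) (Pr c M) => V p1 p2 p3 p4 p5 Pa el.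
rewrite -[RHS]mul1r -Pa -el.
have qcV : q ^- cross N * q ^+ cross N = 1 by rewrite mulVf.
move: qcV; move: (q ^- cross N) (q ^+ cross N) => u v uv.
move: (th a)^-1 (P (a * q) (M + M))^-1 => i1 i2.
rewrite -[RHS]mul1r -uv; ring.
Qed.

(** * Vanishing of the defect *)

(** The product of the y's over all factors th (y * b), the same for the closed form
    and for all summands. *)
Definition norm_b N c : K :=
  (q * c / (f * a)) ^+ tsum N * q ^+ 'C(tsum N, 2) * \prod_r (x r ^+ N r * q ^+ 'C(N r, 2)).

Lemma tsum_sub N k : (forall r, k r <= N r)%N ->
  (\sum_r (N r - k r) = tsum N - tsum k)%N.
Proof. by move=> kN; rewrite sumnB. Qed.

Lemma closed_monomial_b N c : c != 0 ->
  theta_monomial th (tsum N + tsum N) (norm_b N c) (fun b => closed N b c).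
Proof.
move=> c0.
have y0 : q / f != 0 by rewrite mulf_neq0 ?invr_neq0.
have y1 r : c * x r / a != 0 by rewrite !mulf_neq0 ?invr_neq0.
have h1 := theta_monomial_tpoch th q0 (tsum N) y0.
have h2 := theta_monomial_prod (index_enum 'I_n) (P := xpredT) (fun r _ => theta_monomial_tpoch th q0 (N r) (y1 r)).
have h3 := theta_monomial_cst th ((\prod_r (P (f * x r / c) (N r) / P (f * x r) (N r))) /
  \prod_r \prod_s P (q * x r / x s) (N r)).
apply: theta_monomial_ext (theta_monomial_mul (theta_monomial_mul h1 h2) h3).
- move=> b _; rewrite /closed -[RHS]mulrA; congr (_ * _ * _).
    by congr (P _ _); ring.
  by apply: eq_bigr => r _; congr (P _ _); ring.
- by rewrite addn0.
- rewrite mulr1 /norm_b.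
  have -> : (q * c / (f * a)) ^+ tsum N = (q / f) ^+ tsum N * \prod_r (c / a) ^+ N r.
    by rewrite prodrXr -exprMn; congr (_ ^+ _); field; rewrite f0 a0.
  rewrite -!mulrA; congr (_ * _); rewrite mulrCA; congr (_ * _).
  rewrite -big_split; apply: eq_bigr => r _ /=.
  by rewrite mulrA -exprMn; congr (_ ^+ _ * _); ring.
Qed.

(** The powers of q that depend on k cancel in the product of the y's, because
    C(k + l, 2) = C(k, 2) + C(l, 2) + k l, for the single indices and for |k|. *)
Lemma summand_monomial_b N k c : (forall r, k r <= N r)%N -> c != 0 ->
  theta_monomial th (tsum N + tsum N) (norm_b N c)
    (fun b => summand N k b c (a * f / (b * c))).
Proof.
move=> kN c0; set M := tsum N; set L := (M - tsum k)%N; set J := tsum k.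
have qn m : q ^+ m != 0 by rewrite expf_neq0.
have eM : (J + L)%N = M by rewrite addnC subnK // tsum_le.
have y1 r : x r * q ^+ M != 0 by rewrite mulf_neq0.
have y2 r : x r * q ^+ k r / (a * q ^+ J) != 0 by rewrite !(mulf_neq0, invr_neq0).
have y3 : q * c / (a * f * q ^+ J) != 0 by rewrite !(mulf_neq0, invr_neq0).
have y4 : c * q ^+ J.+1 / f != 0 by rewrite !(mulf_neq0, invr_neq0).
have h1 := theta_monomial_prod (index_enum 'I_n) (P := xpredT) (fun r _ => theta_monomial_tpoch th q0 (k r) (y1 r)).
have h2 := theta_monomial_prod (index_enum 'I_n) (P := xpredT) (fun r _ => theta_monomial_tpoch th q0 (N r - k r) (y2 r)).
have h3 := theta_monomial_tpoch th q0 J y3.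
have h4 := theta_monomial_tpoch th q0 L y4.
have h5 := theta_monomial_cst th ((denom N k)^-1 * (P c J * P (a * q ^+ J.+1 / c) L)).
apply: theta_monomial_ext (theta_monomial_mul (theta_monomial_mul (theta_monomial_mul h1 h2) (theta_monomial_mul h3 h4)) h5).
- move=> b b0; rewrite /summand -/M -/J -/L.
  have -> : \prod_r P (b * x r * q ^+ M) (k r) = \prod_r P (x r * q ^+ M * b) (k r).
    by apply: eq_bigr => r _; congr (P _ _); ring.
  have -> : \prod_r P (b * (x r * q ^+ k r) / (a * q ^+ J)) (N r - k r) =
      \prod_r P (x r * q ^+ k r / (a * q ^+ J) * b) (N r - k r).
    by apply: eq_bigr => r _; congr (P _ _); ring.
  have d0 : a * f / (b * c) != 0 by rewrite !(mulf_neq0, invr_neq0).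
  have -> : a * q ^+ J.+1 / (a * f / (b * c)) = c * q ^+ J.+1 / f * b.
    by field; rewrite a0 f0 b0 c0.
  rewrite -(@tpoch_rev _ th _ q0 _ _ d0).
  have -> : q / (a * f / (b * c) * q ^+ J) = q * c / (a * f * q ^+ J) * b.
    by field; rewrite a0 f0 b0 c0 qn.
  by ring.
- by rewrite addn0 tsum_sub // -/J -/L eM.
- rewrite mulr1 -big_split /=.
  have -> : \prod_r ((x r * q ^+ M) ^+ k r * q ^+ 'C(k r, 2) *
      ((x r * q ^+ k r / (a * q ^+ J)) ^+ (N r - k r) * q ^+ 'C(N r - k r, 2))) =
     (\prod_r (x r ^+ N r * q ^+ 'C(N r, 2))) * (q ^+ M) ^+ J / (a * q ^+ J) ^+ L.
    have -> : (q ^+ M) ^+ J = \prod_r (q ^+ M) ^+ k r by rewrite prodrXr.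
    have -> : (a * q ^+ J) ^- L = \prod_r (a * q ^+ J) ^- (N r - k r).
      rewrite -exprVn /L /M {1}/J -tsum_sub // -prodrXr; apply: eq_bigr => r _; exact: exprVn.
    rewrite -!big_split; apply: eq_bigr => r _ /=.
    have : (N r - k r + k r = N r)%N := subnK (kN r).
    move: (N r - k r)%N => l <-.
    by rewrite !exprMn exprVn exprMn -[(q ^+ k r) ^+ _]exprM bin2_add !exprD [(k r * _)%N]mulnC; ring.
  rewrite /norm_b -/M -eM bin2_add !exprD exprS !(exprMn, exprVn) -!exprM ?[(L * J)%N]mulnC.
  move: (\prod_r _) => p; field.
  by rewrite ?a0 ?f0 ?qn ?expf_neq0.
Qed.

Lemma closed_monomial_c N b : b != 0 ->
  theta_monomial th (tsum N + tsum N) ((b / (a * f)) ^+ tsum N)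
    (fun c => c ^+ tsum N * closed N b c).
Proof.
move=> b0.
have y1 r : b * x r / a != 0 by rewrite !mulf_neq0 ?invr_neq0.
have y2 r : f * x r != 0 by rewrite mulf_neq0.
have h1 := theta_monomial_prod (index_enum 'I_n) (P := xpredT) (fun r _ => theta_monomial_tpoch th q0 (N r) (y1 r)).
have h2 := theta_monomial_prod (index_enum 'I_n) (P := xpredT) (fun r _ => theta_monomial_tpochV thP q0 (N r) (y2 r)).
have h3 := theta_monomial_cst th (P (b * q / f) (tsum N) * (\prod_r (P (f * x r) (N r))^-1) /
  \prod_r \prod_s P (q * x r / x s) (N r)).
apply: theta_monomial_ext (theta_monomial_mul (theta_monomial_mul h1 h2) h3).
- move=> c _; rewrite /closed.
  have -> : \prod_r P (b * c * x r / a) (N r) = \prod_r P (b * x r / a * c) (N r).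
    by apply: eq_bigr => r _; congr (P _ _); ring.
  have -> : \prod_r (P (f * x r / c) (N r) / P (f * x r) (N r)) =
      (\prod_r P (f * x r / c) (N r)) * \prod_r (P (f * x r) (N r))^-1 by rewrite -big_split.
  have -> : \prod_r (c ^+ N r * P (f * x r / c) (N r)) = c ^+ tsum N * \prod_r P (f * x r / c) (N r).
    by rewrite -prodrXr -big_split.
  by ring.
- by rewrite addn0.
- rewrite mulr1 -prodrXr -big_split; apply: eq_bigr => r _ /=.
  by rewrite !(exprMn, exprVn); field; rewrite !expf_neq0 ?x0.
Qed.

(** With b and f fixed, d is proportional to 1 / c; the factor c^|N| is distributed
    over the |k| factors of (d)_|k| and the |N| - |k| factors with argument
    a q^i / c. *)
Lemma summand_monomial_c N k b : (forall r, k r <= N r)%N -> b != 0 ->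
  theta_monomial th (tsum N + tsum N) ((b / (a * f)) ^+ tsum N)
    (fun c => c ^+ tsum N * (coef k c * summand N k b c (a * f / (b * c)))).
Proof.
move=> kN b0; set M := tsum N; set L := (M - tsum k)%N; set J := tsum k.
have qn m : q ^+ m != 0 by rewrite expf_neq0.
have eM : (J + L)%N = M by rewrite addnC subnK // tsum_le.
have y1 : a * f / b != 0 by rewrite !(mulf_neq0, invr_neq0).
have y2 : a * q ^+ J.+1 != 0 by rewrite mulf_neq0.
have y3 : b * q ^+ J.+1 / f != 0 by rewrite !(mulf_neq0, invr_neq0).
have h1 := theta_monomial_tpochV thP q0 J y1.
have h2 := theta_monomial_tpochV thP q0 L y2.
have h3 := theta_monomial_tpoch th q0 J (oner_neq0 K).
have h4 := theta_monomial_tpoch th q0 L y3.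
have h5 := theta_monomial_cst th ((denom N k)^-1 * kappa k * b ^+ J *
  ((\prod_r P (b * x r * q ^+ M) (k r)) * \prod_r P (b * (x r * q ^+ k r) / (a * q ^+ J)) (N r - k r))).
apply: theta_monomial_ext (theta_monomial_mul (theta_monomial_mul (theta_monomial_mul h1 h2) (theta_monomial_mul h3 h4)) h5).
- move=> c c0; rewrite /summand -/M -/J -/L.
  have -> : a * q ^+ J.+1 / (a * f / (b * c)) = b * q ^+ J.+1 / f * c.
    by field; rewrite a0 f0 b0 c0.
  rewrite mul1r.
  have E := coef_rpoch k b0 c0; rewrite -/J in E.
  have -> : a * f / b / c = a * f / (b * c) by rewrite invfM; ring.
  have -> : c ^+ M = c ^+ J * c ^+ L by rewrite -eM exprD.
  move: E; move: (coef k c) (Pr _ _) (P (a * f / (b * c)) J) => u v w E.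
  have -> : forall z1 z2 z3 z4 z5 z6 : K, z1 * z2 * (u * (z3 * z4 * (v * z5) * z6)) =
    (u * v) * (z1 * z2 * z3 * z4 * z5 * z6) by move=> *; ring.
  by rewrite E; ring.
- by rewrite addn0 eM.
- rewrite mulr1 expr1n -eM exprD !(exprMn, exprVn).
  have q1 : q ^+ J.+1 ^+ L != 0 by rewrite expf_neq0.
  by field; rewrite !expf_neq0.
Qed.

Lemma lt_tsum N k : (forall r, k r <= N r)%N -> (exists r, k r < N r)%N ->
  (tsum k < tsum N)%N.
Proof. by move=> kN [r kr]; apply: tsum_lt kr. Qed.

(** For d = a q^|N| the last factor of (a q^(|k|+1) / d)_(|N|-|k|) is th 1. *)
Lemma summand_low N k b c : (forall r, k r <= N r)%N -> (exists r, k r < N r)%N ->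
  summand N k b c (a * q ^+ tsum N) = 0.
Proof.
move=> kN kr; have /[!ltnNge] kM := lt_tsum kN kr.
have [m eM] : exists m, tsum N = ((tsum k).+1 + m)%N.
  by exists (tsum N - (tsum k).+1)%N; rewrite subnKC // ltnNge.
rewrite /summand eM addSn -addnS addKn tpochS.
have -> : a * q ^+ (tsum k).+1 / (a * q ^+ (tsum k + m.+1)) * q ^+ m = 1.
  rewrite addnS -addSn exprD; field; rewrite a0 !expf_neq0 //.
by rewrite (th_one thP); ring.
Qed.

Lemma th_qq i j : i != j -> th (q ^+ i / q ^+ j) != 0.
Proof.
have lt (u v : nat) : (u < v)%N -> th (q ^+ v / q ^+ u) != 0.
  move=> uv; rewrite -(subnK uv) -addSnnS exprD mulfK ?expf_neq0 //.
case: (ltngtP i j) => // [ij|ij] _; last exact: lt.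
by apply: (th_neq0_sym thP) (lt _ _ ij); rewrite expf_neq0.
Qed.

(** Two exceptions m <> m' would make th (q^m / q^m') vanish. *)
Lemma th_eventually s : s != 0 -> exists m0, forall m, (m0 <= m)%N -> th (s / q ^+ m) != 0.
Proof.
move=> s0; have [[m1 h1]|none] := pselect (exists m1, th (s / q ^+ m1) = 0); last first.
  by exists 0%N => m _; apply/eqP => h; apply: none; exists m.
exists m1.+1 => m lt; apply/eqP => h.
have sq j : s / q ^+ j != 0 by rewrite mulf_neq0 ?invr_neq0 ?expf_neq0.
have := th_zero_div thP (sq m1) (sq m) h1 h.
have -> : s / q ^+ m1 / (s / q ^+ m) = q ^+ m / q ^+ m1.
  by field; rewrite s0 !expf_neq0.
by apply/eqP; apply: th_qq; rewrite gtn_eqF.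
Qed.

Lemma th_eventually_fin (s : 'I_n -> K) : (forall r, s r != 0) ->
  exists m0, forall r m, (m0 <= m)%N -> th (s r / q ^+ m) != 0.
Proof.
move=> s0; have [g gP] := fin_all_exists (fun r => th_eventually (s0 r)).
exists (\max_r g r)%N => r m gm; apply: gP; apply: leq_trans gm; exact: leq_bigmax.
Qed.

Section Bounded.
Variable B : nat.
Local Notation multi := {ffun 'I_n -> 'I_B.+1}.
Implicit Type u : multi.

Definition below N u : bool := [forall r, u r <= N r]%N.

(** The summation index has the fixed bound B, and the condition below N selects
    the terms; so the index type does not change when N decreases in the induction. *)
Definition defect N b c : K :=
  \sum_(u : multi | below N u)
    coef (fun r => u r) c * summand N (fun r => u r) b c (a * f / (b * c)) - closed N b c.

Lemma belowP N u : reflect (forall r, u r <= N r)%N (below N u).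
Proof. exact: forallP. Qed.

Lemma below_dec N u r : (0 < N r)%N -> below (dec N r) u = below N u && (u r < N r)%N.
Proof.
move=> Nr; apply/belowP/andP => [h|[/belowP h ur] s]; rewrite /dec.
  split; first by apply/belowP => s; apply: leq_trans (h s) _; exact: leq_subr.
  by rewrite -(prednK Nr) ltnS; have := h r; rewrite /dec eqxx subn1.
by case: eqVneq => [->|_]; rewrite ?subn0 //= subn1 -ltnS prednK.
Qed.

Lemma below_top N u : below N u -> (forall r, u r = N r :> nat) \/ exists r, (u r < N r)%N.
Proof.
move=> /belowP h; case: (pselect (exists r, (u r < N r)%N)) => [|none]; first by right.
left=> r; apply/eqP; rewrite eqn_leq h leqNgt /=; apply/negP => lt; apply: none; by exists r.
Qed.

Lemma summand_rec_below N u b c d : below N u ->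
  b != 0 -> c != 0 -> d != 0 -> b * c * (d * q) = a * f ->
  (forall r, th (b * (x r * q ^+ N r) * q ^+ tsum N) != 0) ->
  (\prod_r th (b * (x r * q ^+ N r) * q ^+ tsum N)) * th d^-1 *
    summand N (fun r => u r) b c (d * q) =
  (\prod_r th (b * x r * q ^+ tsum N)) * th (d * q ^+ tsum N)^-1 *
    summand N (fun r => u r) (b * q) c d +
  \sum_(r | (u r < N r)%N) rec_weight N b c d r * summand (dec N r) (fun r => u r) (b * q) c d.
Proof.
move=> uN b0 c0 d0 bcd D0; case: (below_top uN) => [top|[r0 ur0]].
  rewrite [X in _ + X]big1 => [|r]; last by rewrite top ltnn.
  have -> : (fun r => nat_of_ord (u r)) = N by apply/funext => r; rewrite top.
  by rewrite addr0; apply: summand_rec_top.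
by apply: (summand_rec (r0 := r0)) => //; apply/belowP.
Qed.

(** In the double sum over u below N and r with u r < N r, the order of summation
    is reversed: such pairs are those with 0 < N r and u below dec N r. *)
Lemma defect_rec N b c d r0 : (0 < N r0)%N ->
  b != 0 -> c != 0 -> d != 0 -> b * c * (d * q) = a * f ->
  (forall r, th (b * (x r * q ^+ N r) * q ^+ tsum N) != 0) ->
  (\prod_r th (b * (x r * q ^+ N r) * q ^+ tsum N)) * th d^-1 * defect N b c =
  (\prod_r th (b * x r * q ^+ tsum N)) * th (d * q ^+ tsum N)^-1 * defect N (b * q) c +
  \sum_(r | (0 < N r)%N) rec_weight N b c d r * defect (dec N r) (b * q) c.
Proof.
move=> Nr0 b0 c0 d0 bcd D0.
have dq : a * f / (b * c) = d * q by rewrite -bcd; field; rewrite b0 c0.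
have dE : a * f / (b * q * c) = d by rewrite -bcd; field; rewrite b0 c0 q0.
have H := closed_rec Nr0 b0 c0 d0 bcd D0.
rewrite /defect dE dq !mulrBr H.
set D := \prod_r _ * _; set D' := \prod_r _ * _.
have -> : D * \sum_(u | below N u) coef (fun r => u r) c * summand N (fun r => u r) b c (d * q) =
   D' * \sum_(u | below N u) coef (fun r => u r) c * summand N (fun r => u r) (b * q) c d +
   \sum_(r | (0 < N r)%N) rec_weight N b c d r *
     \sum_(u | below (dec N r) u) coef (fun r => u r) c * summand (dec N r) (fun r => u r) (b * q) c d.
  rewrite !mulr_sumr.
  transitivity (\sum_(u | below N u) (D' * (coef (fun r => u r) c * summand N (fun r => u r) (b * q) c d) +
     \sum_(r | (u r < N r)%N) coef (fun r => u r) c * (rec_weight N b c d r * summand (dec N r) (fun r => u r) (b * q) c d))).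
    apply: eq_bigr => u uN; rewrite mulrCA summand_rec_below // -/D' mulrDr mulrCA; congr (_ + _).
    by rewrite mulr_sumr.
  rewrite big_split /=; congr (_ + _).
  rewrite (exchange_big_dep (fun r => 0 < N r)%N) /=; last by move=> u r _; apply: leq_ltn_trans.
  apply: eq_bigr => r Nr; rewrite mulr_sumr; apply: eq_big => [u|u _]; first by rewrite below_dec.
  by rewrite mulrCA.
have -> : \sum_(r | (0 < N r)%N) rec_weight N b c d r *
    (\sum_(u | below (dec N r) u) coef (fun r => u r) c *
        summand (dec N r) (fun r => u r) (b * q) c d - closed (dec N r) (b * q) c) =
   \sum_(r | (0 < N r)%N) rec_weight N b c d r *
     (\sum_(u | below (dec N r) u) coef (fun r => u r) c * summand (dec N r) (fun r => u r) (b * q) c d) -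
   \sum_(r | (0 < N r)%N) rec_weight N b c d r * closed (dec N r) (b * q) c.
  by rewrite -sumrB; apply: eq_bigr => r _; rewrite mulrBr.
by ring.
Qed.

Lemma defect_top N b c : (forall r, N r <= B)%N -> b != 0 -> c != 0 ->
  b * c * q ^+ tsum N = f -> defect N b c = 0.
Proof.
move=> NB b0 c0 bcf; rewrite /defect.
have -> : a * f / (b * c) = a * q ^+ tsum N by rewrite -bcf; field; rewrite b0 c0.
pose top : multi := [ffun r => inord (N r)].
have topE r : top r = N r :> nat by rewrite ffunE inordK // ltnS.
have topN : (fun r => nat_of_ord (top r)) = N by apply/funext.
rewrite (bigD1 top) /=; last by apply/belowP => r; rewrite topE.
rewrite topN summand_top // big1 ?addr0 ?subrr // => u /andP[uN utop].
case: (below_top uN) => [all|low].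
  by case/eqP: utop; apply/ffunP => r; apply/val_inj; rewrite /= topE all.
by rewrite summand_low ?mulr0 //; apply/belowP.
Qed.

Lemma defect_fun_b N c : c != 0 ->
  theta_fun th (tsum N + tsum N) (norm_b N c) (fun b => defect N b c).
Proof.
move=> c0; apply: theta_fun_sub; last first.
  by apply: (theta_monomial_fun thP); apply: closed_monomial_b.
apply: theta_fun_sum => u /belowP uN; apply: theta_fun_scale.
by apply: (theta_monomial_fun thP); apply: summand_monomial_b.
Qed.

Lemma defect_fun_c N b : b != 0 ->
  theta_fun th (tsum N + tsum N) ((b / (a * f)) ^+ tsum N) (fun c => c ^+ tsum N * defect N b c).
Proof.
move=> b0; apply: (@theta_fun_ext _ _ _ _ (fun c =>
   \sum_(u : multi | below N u) c ^+ tsum N * (coef (fun r => u r) c * summand N (fun r => u r) b c (a * f / (b * c)))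
   - c ^+ tsum N * closed N b c)).
  by move=> c _; rewrite /defect mulrBr mulr_sumr.
apply: theta_fun_sub; last first.
  by apply: (theta_monomial_fun thP); apply: closed_monomial_c.
apply: theta_fun_sum => u /belowP uN.
by apply: (theta_monomial_fun thP); apply: summand_monomial_c.
Qed.

(** Induction on |N|.  For c = q^(m0 + i) the defect vanishes at the points
    w j = f / (c q^(|N| + j)), which correspond to d = a q^(|N| + j): for j = 0 by
    defect_top, and then by the recurrence, whose right-hand side vanishes at
    b = w j.+1.  So it vanishes for all b and these c, and then for all c.  If
    |N| = 0, the defect does not depend on b. *)
Lemma defect_eq0 N b c : (forall r, N r <= B)%N -> b != 0 -> c != 0 -> defect N b c = 0.
Proof.
have [m] := ubnP (tsum N); elim: m N b c => // m IH N b c lt NB b0 c0.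
have qn i : q ^+ i != 0 by rewrite expf_neq0.
have [N0|M0] := posnP (tsum N).
  have Nz r : N r = 0%N by apply/eqP; rewrite -leqn0 -N0 le_tsum.
  pose b1 := f / c; have b10 : b1 != 0 by rewrite mulf_neq0 ?invr_neq0.
  have const t g : theta_monomial th (tsum N + tsum N) t g -> g b = g b1.
    rewrite N0 => -[u [ys [/size0nil -> _ _ gE]]].
    by rewrite !gE // !big_nil.
  have -> : defect N b c = defect N b1 c.
    rewrite /defect; congr (_ - _); last first.
      by apply: (const (norm_b N c) (fun b => closed N b c)); apply: closed_monomial_b.
    apply: eq_bigr => u /belowP uN; congr (_ * _).
    apply: (const (norm_b N c) (fun b => summand N (fun r => u r) b c (a * f / (b * c)))).
    exact: summand_monomial_b.
  by apply: defect_top; rewrite // N0 mulr1 /b1 divfK.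
have [r0 Nr0] : exists r0, (0 < N r0)%N.
  apply/existsP; move: M0; rewrite lt0n; apply: contraR => /existsPn h.
  by rewrite /tsum big1 // => r _; apply/eqP; rewrite -leqn0 leqNgt.
have s0 r : f * x r * q ^+ N r != 0 by rewrite !mulf_neq0.
have [m0 m0P] := th_eventually_fin s0.
(* Beyond m0, the product of thetas on the left of the recurrence is nonzero at
   all the points w j.+1. *)
have good_c i b' : b' != 0 -> defect N b' (q ^+ (m0 + i)) = 0.
  move=> b'0; set C := q ^+ (m0 + i); have C0 : C != 0 := qn _.
  pose w j := f / (C * q ^+ (tsum N + j)).
  have w0 j : w j != 0 by rewrite !(mulf_neq0, invr_neq0).
  refine (@theta_fun_zeros _ _ thP _ _ _ b' w (@defect_fun_b N _ C0) M0 _ w0 _ _ _) => //.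
  - rewrite /norm_b !mulf_neq0 ?expf_neq0 ?mulf_neq0 ?invr_neq0 ?mulf_neq0 //.
    by apply/prodf_neq0 => r _; rewrite mulf_neq0 ?expf_neq0.
  - move=> u v uv; have -> : w u / w v = q ^+ v / q ^+ u.
      by rewrite /w !exprD; field; rewrite f0 C0 !qn.
    by apply: th_qq; rewrite // eq_sym.
  elim=> [|j IHj].
    apply: defect_top => //; rewrite /w addn0; field; by rewrite C0 qn.
  have wq : w j.+1 * q = w j by rewrite /w addnS exprSr; field; rewrite C0 qn q0.
  have d0 : a * q ^+ (tsum N + j) != 0 by rewrite mulf_neq0.
  have bcd : w j.+1 * C * (a * q ^+ (tsum N + j) * q) = a * f.
    by rewrite /w addnS exprSr; field; rewrite C0 qn q0.
  have D0 r : th (w j.+1 * (x r * q ^+ N r) * q ^+ tsum N) != 0.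
    have -> : w j.+1 * (x r * q ^+ N r) * q ^+ tsum N = f * x r * q ^+ N r / q ^+ (m0 + (i + j.+1)).
      by rewrite /w /C !exprD; field; rewrite !qn.
    by apply: m0P; exact: leq_addr.
  have := defect_rec Nr0 (w0 j.+1) C0 d0 bcd D0.
  rewrite wq IHj mulr0 add0r [X in _ = X]big1 => [/eqP|r Nr].
    rewrite !mulf_eq0 => /orP[/orP[|]|/eqP //].
      by move/negPn/negP; case; apply/prodf_neq0 => r _.
    rewrite -[(_)^-1]mul1r => /negPn/negP; case.
    by apply: (th_neq0_sym thP) => //; rewrite ?oner_neq0 // divr1.
  rewrite IH ?mulr0 // ?tsum_dec // => s; apply: leq_trans (NB s); exact: leq_subr.
pose w i := q ^+ (m0 + i).
have : c ^+ tsum N * defect N b c = 0.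
  refine (@theta_fun_zeros _ _ thP _ _ _ c w (@defect_fun_c N _ b0) M0 _ _ _ _ c0) => //.
  - by rewrite expf_neq0 // !(mulf_neq0, invr_neq0).
  - move=> i; exact: qn.
  - by move=> i j ij; apply: th_qq; rewrite // eqn_add2l.
  - by move=> i; rewrite good_c // mulr0.
by move/eqP; rewrite mulf_eq0 expf_eq0 (negbTE c0) andbF => /eqP.
Qed.
End Bounded.
End Jackson.

(** * The Bailey pair *)

Local Arguments qpfact : simpl never.

Section Assembly.
Variables (K : numFieldType) (n : nat) (q p : K) (x : 'I_n -> K) (c d a b : K).
Hypotheses (n0 : (0 < n)%N) (q0 : q != 0) (thP : theta_like (theta p)).
Hypothesis gen : generic3 q p x c d a b.
Implicit Types (N k : 'I_n -> nat).
Local Notation th := (theta p).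
Local Notation P := (tpoch th q).
Local Notation f := (b * c * d / a).

Lemma qpfact_tpoch z m : qpfact q p z (Posz m) = P z m.
Proof. by []. Qed.

Lemma qpfact_sub z (i j : nat) : (j <= i)%N -> qpfact q p z (i%:Z - j%:Z) = P z (i - j).
Proof. by move=> ji; rewrite subzn. Qed.

Let a0 : a != 0 := generic3_a gen.
Let b0 : b != 0 := generic3_b gen.
Let c0 : c != 0 := generic3_c gen.
Let d0 : d != 0 := generic3_d gen.
Let x0 r : x r != 0 := generic3_x gen r.

Let f0 : f != 0.
Proof. by rewrite !mulf_neq0 ?invr_neq0. Qed.

Lemma tpoch_last z m : P z m.+1 != 0 -> th (z * q ^+ m) != 0.
Proof. by rewrite tpochS mulf_eq0 negb_or => /andP[]. Qed.

Let th_aq m : th (a * q ^+ m) != 0.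
Proof.
case: m => [|m]; first by rewrite mulr1 (generic3_theta gen).
by rewrite exprS mulrA; apply: tpoch_last; apply: (generic3_aq gen m.+1).
Qed.

Let th_q m : th (q ^+ m.+1) != 0.
Proof.
have := generic3_xx gen (k := fun=> m.+1) (j := fun=> 0%N) (fun=> isT) (Ordinal n0) (Ordinal n0).
cbv beta; rewrite qpfact_sub // subn0 => /tpoch_last.
by rewrite addrK mulfK ?x0 // expr1z -exprS.
Qed.

Let th_xx r s i j : r != s -> th (x r * q ^+ i / (x s * q ^+ j)) != 0.
Proof.
move=> rs.
(* These tuples make the first factor of the denominator of B equal to the
   wanted theta. *)
pose k t := if t == r then i.+1 else j.+1; pose l t := if t == r then i else j.+1.
have lk t : (l t <= k t)%N by rewrite /l /k; case: ifP.
have := generic3_xx gen lk r s; rewrite qpfact_sub // /k /l eqxx [s == r]eq_sym (negbTE rs) subSnn.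
move=> /tpoch_last; rewrite mulr1.
have -> : (1 + i%:Z - j.+1%:Z = i%:Z - j%:Z)%R by rewrite intS; ring.
by rewrite expfzDr // -exprnN -exprnP; congr (th _ != 0); rewrite invfM; ring.
Qed.

Let th_fx r m : th (f * x r * q ^+ m) != 0.
Proof.
have := generic3_bcdx gen m.+1 r; rewrite qpfact_tpoch => /tpoch_last.
by congr (th _ != 0); ring.
Qed.

Lemma aaq_bcd r : a ^+ 2 * q / (b * c * d * x r) = a * q / (f * x r).
Proof. by field; rewrite a0 b0 c0 d0 x0. Qed.

Let P_e k r : P (a * q / (f * x r)) (tsum k - k r) != 0.
Proof. by have := generic3_aaq gen k r; rewrite qpfact_sub ?le_tsum // aaq_bcd. Qed.

(** The factors of B and beta that do not depend on the summation index. *)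
Definition prefactor N : K :=
  (\prod_r P (b * x r) (tsum N)) / (P (a * q / c) (tsum N) * P (a * q / d) (tsum N)).

Lemma Bailey_term N k : (forall r, k r <= N r)%N ->
  B3 q p x a b N k * alpha3 q p x c d a b k =
  prefactor N * (coef th q a f x k c * summand th q a x N k b c (a * f / (b * c))).
Proof.
move=> kN; have KM : (tsum k <= tsum N)%N := tsum_le kN.
have dE : a * f / (b * c) = d by field; rewrite a0 b0 c0.
have E := coef_rpoch thP x q0 a0 f0 k b0 c0; rewrite dE in E.
rewrite dE.
have -> : B3 q p x a b N k = (denom th q a x N k)^-1 *
   ((\prod_r P (b * x r) (tsum N)) * (\prod_r P (b * x r * q ^+ tsum N) (k r)) *
    \prod_r P (b * (x r * q ^+ k r) / (a * q ^+ tsum k)) (N r - k r)).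
  rewrite /B3 mulrC; congr (_^-1 * _).
    rewrite /denom qpfact_tpoch; congr (_ * _).
    apply: eq_bigr => r _; apply: eq_bigr => s _; rewrite qpfact_sub //; congr (P _ _).
    by rewrite -addrA !expfzDr // -exprnN -exprnP expr1z invfM; ring.
  rewrite -!big_split; apply: eq_bigr => r _ /=.
  rewrite qpfact_sub // qpfact_tpoch addnC tpochD; congr (_ * P _ _).
  by rewrite expfzDr // -exprnN -exprnP invfM; ring.
have shift z : z != 0 -> P (a * q / z) (tsum N) != 0 -> 
   P (a * q ^+ (tsum k).+1 / z) (tsum N - tsum k) / P (a * q / z) (tsum N) = (P (a * q / z) (tsum k))^-1.
  move=> z0; rewrite -{1 3}(subnKC KM) tpochD mulf_eq0 negb_or => /andP[u0 v0].
  have -> : a * q ^+ (tsum k).+1 / z = a * q / z * q ^+ tsum k by rewrite exprS; ring.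
  by field; rewrite u0 v0.
have Sc := shift c c0 (generic3_aqc gen (tsum N)).
have Sd := shift d d0 (generic3_aqd gen (tsum N)).
have -> : alpha3 q p x c d a b k = kappa th q a f x k * b ^+ tsum k * P d (tsum k) * P c (tsum k) /
    (P (a * q / c) (tsum k) * P (a * q / d) (tsum k)).
  rewrite /alpha3 /kappa !qpfact_tpoch.
  have -> : \prod_r (qpfact q p (a ^+ 2 * q / (b * c * d * x r)) (tsum k) /
            (qpfact q p (a ^+ 2 * q / (b * c * d * x r)) ((tsum k)%:Z - (k r)%:Z) *
             qpfact q p (b * c * d * x r / a) (k r))) =
     \prod_r (P (a * q / (f * x r)) (tsum k) /
       (P (a * q / (f * x r)) (tsum k - k r) * P (f * x r) (k r))).
    apply: eq_bigr => r _; rewrite qpfact_sub ?le_tsum // !qpfact_tpoch aaq_bcd.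
    by have -> : b * c * d * x r / a = f * x r by ring.
  rewrite -/(cross k) expr_div_n.
  have -> : \prod_r \prod_s qpfact q p (q * x r / x s) (k r) = \prod_r \prod_s P (q * x r / x s) (k r) by [].
  move: (\prod_r \prod_s _) (\prod_r (_ / _)) (\prod_r _ ^+ _) (q ^- _) (a ^- _) (th a)^-1 => v1 v2 v3 v4 v5 v6.
  by rewrite !invfM; ring.
rewrite -E [(P (a * q / c) (tsum k) * _)^-1]invfM -Sc -Sd /prefactor /summand.
rewrite [(P (a * q / c) (tsum N) * _)^-1]invfM.
move: (denom _ _ _ _ _ _)^-1 (P (a * q / c) _)^-1 (P (a * q / d) _)^-1 => v1 v2 v3.
by ring.
Qed.

Lemma Bailey_closed N : beta3 q p x c d a b N = prefactor N * closed th q a f x N b c.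
Proof.
rewrite /beta3 /closed /prefactor !qpfact_tpoch.
have -> : b * q / f = a * q / (c * d) by field; rewrite a0 b0 c0 d0.
have -> : \prod_r \prod_s (qpfact q p (q * x r / x s) (N r))^-1 = (\prod_r \prod_s P (q * x r / x s) (N r))^-1.
  by rewrite -prodfV; apply: eq_bigr => r _; rewrite prodfV.
have -> : \prod_r (qpfact q p (b * x r) (tsum N) * (qpfact q p (b * c * x r / a) (N r) *
             qpfact q p (b * d * x r / a) (N r)) / qpfact q p (b * c * d * x r / a) (N r)) =
   (\prod_r P (b * x r) (tsum N)) * (\prod_r P (b * c * x r / a) (N r)) *
   \prod_r (P (f * x r / c) (N r) / P (f * x r) (N r)).
  rewrite -!big_split; apply: eq_bigr => r _ /=; rewrite !qpfact_tpoch.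
  have -> : b * c * d * x r / a = f * x r by ring.
  have -> : b * d * x r / a = f * x r / c by field; rewrite a0 c0.
  by ring.
by ring.
Qed.

(** The sum over tuples bounded by N componentwise is the sum over the tuples with
    entries at most |N| that lie below N. *)
Theorem Bailey_pair_of_theta_like :
  WP_Bailey_pair (B3 q p x) (alpha3 q p x c d) (beta3 q p x c d) a b.
Proof.
move=> N; pose B := tsum N.
have NB r : (N r <= B)%N := le_tsum N r.
have := defect_eq0 thP q0 a0 f0 x0 th_aq th_q th_xx th_fx P_e NB b0 c0.
move=> /eqP; rewrite subr_eq0 => /eqP E.
rewrite Bailey_closed -E mulr_sumr.
pose h (j : {dffun forall r : 'I_n, 'I_(N r).+1}) : {ffun 'I_n -> 'I_B.+1} :=
  [ffun r => widen_ord (NB r : (N r).+1 <= B.+1)%N (j r)].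
pose g (u : {ffun 'I_n -> 'I_B.+1}) : {dffun forall r : 'I_n, 'I_(N r).+1} :=
  [ffun r : 'I_n => inord (u r) : 'I_(N r).+1].
rewrite (reindex_onto h g) /=; last first.
  move=> u /belowP uN; apply/ffunP => r; apply/val_inj.
  by rewrite !ffunE /= inordK // ltnS.
apply: eq_big => [j|j _].
  have -> : g (h j) = j by apply/ffunP => r; apply/val_inj; rewrite !ffunE /= inordK.
  by rewrite eqxx andbT; apply/belowP => r; rewrite ffunE /= -ltnS.
have -> : (fun r => nat_of_ord (h j r)) = (fun r => nat_of_ord (j r)).
  by apply/funext => r; rewrite ffunE.
by rewrite Bailey_term // => r; rewrite -ltnS.
Qed.
End Assembly.

Lemma theta_theta_like (R : realType) (p : R[i]) : `|p| < 1 -> theta_like (theta p).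
Proof.
rewrite modulus_lt1 => p1; split.
- exact: theta1.
- exact: theta_inv.
- exact: theta_zero_div.
- exact: theta_three_term.
Qed.

Theorem theorem5p6 (R : realType) (n : nat) (hn : (1 <= n)%N)
    (q p : R[i]) (hq : q != 0) (hp : `|p| < 1)
    (x : 'I_n -> R[i]) (c d a b : R[i])
    (hgen : generic3 q p x c d a b) :
  WP_Bailey_pair (B3 q p x) (alpha3 q p x c d) (beta3 q p x c d) a b.
Proof.
exact: (Bailey_pair_of_theta_like hn hq (theta_theta_like hp) hgen).
Qed.
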